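(* Let $L$ be a valid lattice and $\{v_0^*,v_1^*\}$ a flux-connecting basis of $L^*$. Decompose $\mathscr{F}(L)$ in lines parallel to $v_0^*$ and in lines parallel to $v_1^*$. Then, along any given one of those lines, the sign change between two adjacent fluxes is always the same; moreover, for parallel and adjacent lines, the sign changes along the two lines are different. Explicitly, let $\{i,j\}=\{0,1\}$ and let $\varphi,\varphi'$ be such that $\varphi,\ \varphi+v_i^*,\ \varphi',\ \varphi'+v_i^*\in\mathscr{F}(L)$. If $\varphi'-\varphi\in\mathbb{Z}v_i^*$, then $$\frac{\operatorname{sgn}(\varphi)}{\operatorname{sgn}(\varphi+v_i^* )}=\frac{\operatorname{sgn}(\varphi')}{\operatorname{sgn}(\varphi'+v_i^* )},$$ and if $\varphi'-\varphi\in v_j^*+\mathbb{Z}v_i^*$, then $$\frac{\operatorname{sgn}(\varphi)}{\operatorname{sgn}(\varphi+v_i^* )}=-\frac{\operatorname{sgn}(\varphi')}{\operatorname{sgn}(\varphi'+v_i^* )}.$$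
   Context: Tilings: the unit square $[i,i+1]\times[j,j+1]$ ($i,j\in\mathbb{Z}$) is black if $i+j$ is even and white otherwise. A domino is the union of two unit squares sharing a side; a tiling of $\mathbb{Z}^2$ is a set of dominoes with pairwise disjoint interiors covering $\mathbb{R}^2$. Let $\mathscr{E}=2\mathbb{Z}^2$, $\mathscr{O}=2\mathbb{Z}^2+(1,1)$. A valid lattice is a subgroup $L\subset\mathbb{Z}^2$ generated by two linearly independent vectors in $\mathscr{E}\sqcup\mathscr{O}$. A tiling of $\mathbb{T}_L=\mathbb{R}^2/L$ is identified with an $L$-periodic tiling of $\mathbb{Z}^2$. Height functions and flux: each unit edge between neighboring points of $\mathbb{Z}^2$ is oriented so that the boundary of every black square is oriented clockwise. The height function $h_t:\mathbb{Z}^2\to\mathbb{Z}$ of a tiling $t$ satisfies $h_t(0)=0$ and, for every edge oriented from $u$ to $w$: $h_t(w)=h_t(u)+1$ if the edge is not the common side of the two squares of a domino of $t$, and $h_t(w)=h_t(u)-3$ otherwise. For a tiling $t$ of $\mathbb{T}_L$, the flux is the unique $\varphi_t\in\mathbb{R}^2$ with $4\langle\varphi_t,v\rangle=h_t(u+v)-h_t(u)$ for all $v\in L$, $u\in\mathbb{Z}^2$. $\mathscr{F}(L)$ is the set of fluxes of all tilings of $\mathbb{T}_L$. The dual lattice is $L^*=\{f\in\mathbb{R}^2:\langle f,v\rangle\in\mathbb{Z}\ \forall v\in L\}$; differences of elements of $\mathscr{F}(L)$ lie in $L^*$. Flux-connecting basis: a basis $\{v_0^*,v_1^*\}$ of $L^*$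 such that any two elements of $\mathscr{F}(L)$ can be joined by a finite sequence of elements of $\mathscr{F}(L)$ whose consecutive differences all lie in $\{\pm v_0^*,\pm v_1^*\}$. Kasteleyn matrix: let $x_0$ be the smallest positive integer with $v_0=(x_0,0)\in L$, $y_1$ the smallest positive integer such that $L$ contains a vector with second coordinate $y_1$, and $v_1=(x_1,y_1)$ the unique such vector in $L$ with $0\le x_1<x_0$; $\{v_0,v_1\}$ generates $L$. The rectangle $D_L=[0,x_0]\times[0,y_1]$ is a fundamental domain with equally many black and white squares; fix enumerations $b_1,\dots,b_m$ of its black and $w_1,\dots,w_m$ of its white squares. Let $G(\mathbb{Z}^2)$ be the graph whose vertices are the centers of unit squares, with edges joining centers of squares sharing a side (edges correspond to dominoes). An edge has sign $-1$ if it is horizontal with black left endpoint and white right endpoint, and $+1$ otherwise. Let $u(0)$ be the straight lattice path from $(0,0)$ to $v_0$ and $u(1)$ the lattice path $(0,0)\to(0,y_1)\to(x_1,y_1)$. Each $L$-orbit $[e]_L$ of edges has weight: its sign, multiplied for each $k\in\{0,1\}$ by $q_k$ (resp. $q_k^{-1}$) if some edge in $[e]_L$ crosses $u(k)$ with its black endpoint to the left (resp. right) of the oriented path $u(k)$. $K(i,j)$ is the sum of the weights of the $L$-orbits of edges joining an $L$-translate of $b_i$ to an $L$-translate of $w_j$. Sign of a flux: each tiling $t$ of $\mathbb{T}_L$ corresponds to a term $K_t=\pm q_0^{n_0}q_1^{n_1}$ in the combinatorial expansion of $\det K$ (permutation sign included), and all tilings with the same flux $\varphi$ yield the same monomial $q_0^{n_0}q_1^{n_1}$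 with the same sign; this common sign is $\operatorname{sgn}(\varphi)$. Equivalently, $\operatorname{sgn}(\varphi)$ is the sign of the coefficient in $\det K$ of $q_0^{n_0}q_1^{n_1}$, where $n_0=\langle\varphi,v_0\rangle$, and $n_1=\langle\varphi,v_1\rangle$ if $v_1\in\mathscr{E}$, $n_1=\langle\varphi,v_1\rangle-\frac12$ if $v_1\in\mathscr{O}$. *)

(* Defs.v *)
From HB Require Import structures.
From mathcomp Require Import all_boot all_order all_algebra.
From mathcomp Require Import finmap.
From mathcomp.multinomials Require Import monalg.
From mathcomp Require Import boolp classical_sets reals.

Set Implicit Arguments.
Unset Strict Implicit.
Unset Printing Implicit Defensive.

Import Order.TTheory GRing.Theory Num.Theory.

Local Open Scope ring_scope.

(* Laurent polynomials in q_0 and q_1, the monomial q_0^m q_1^n being the pair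
   (m, n). The ring structure that monalg puts on {malg _[_]} needs monomials
   without inverses, so the product (convolution) is defined here. *)
Definition laurent : Type := {malg int[(int * int)%type]}.

HB.instance Definition _ :=
  GRing.Zmodule.copy laurent {malg int[(int * int)%type]}.

Definition lmonom (c : int) (k : int * int) : laurent := mkmalgU k c.

Definition lcoef (k : int * int) (f : laurent) : int := mcoeff k f.

Definition lmul (f g : laurent) : laurent :=
  \sum_(k <- msupp f) \sum_(l <- msupp g) lmonom (lcoef k f * lcoef l g) (k + l).

Section LaurentRing.
Implicit Types (f g h : laurent) (k l : int * int).

Lemma lmonomD k (a b : int) : lmonom (a + b) k = lmonom a k + lmonom b k.
Proof. exact: (monalgUD k). Qed.

Lemma lmonom0 k : lmonom 0 k = 0.
Proof. exact: monalgU0. Qed.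

Lemma lmulw (d1 d2 : {fset (int * int)%type}) f g :
  (msupp f `<=` d1)%fset -> (msupp g `<=` d2)%fset ->
  lmul f g =
  \sum_(k <- d1) \sum_(l <- d2) lmonom (lcoef k f * lcoef l g) (k + l).
Proof.
move=> le1 le2; rewrite /lmul (big_fset_incl _ le1) /=.
  apply: eq_bigr => k _; apply: big_fset_incl => // l _ /mcoeff_outdom gl.
  by rewrite /lcoef gl mulr0 lmonom0.
move=> k _ /mcoeff_outdom fk; rewrite big1 // => l _.
by rewrite /lcoef fk mul0r lmonom0.
Qed.

Lemma lmulC : commutative lmul.
Proof.
move=> f g; rewrite /lmul exchange_big; apply: eq_bigr => k _.
by apply: eq_bigr => l _; rewrite mulrC addrC.
Qed.

Lemma lmulDl : left_distributive lmul +%R.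
Proof.
move=> f g h; have hh : (msupp h `<=` msupp h)%fset by [].
rewrite (lmulw (msuppD_le f g) hh) (lmulw (fsubsetUl _ (msupp g)) hh).
rewrite (lmulw (fsubsetUr (msupp f) _) hh).
rewrite -big_split /=; apply: eq_bigr => k _.
rewrite -big_split /=; apply: eq_bigr => l _.
by rewrite -lmonomD -mulrDl /lcoef mcoeffD.
Qed.

Lemma lmulDr : right_distributive lmul +%R.
Proof. by move=> f g h; rewrite ![lmul f _]lmulC lmulDl. Qed.

Lemma lmul0l : left_zero 0 lmul.
Proof. by move=> f; rewrite /lmul msupp0 big_seq_fset0. Qed.

Lemma lmul0r : right_zero 0 lmul.
Proof. by move=> f; rewrite lmulC lmul0l. Qed.

Lemma lmonomM c d k l : lmul (lmonom c k) (lmonom d l) = lmonom (c * d) (k + l).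
Proof.
rewrite (lmulw msuppU_le msuppU_le) !big_seq_fset1.
by rewrite /lcoef !mcoeffUU.
Qed.

Lemma laurentE f : f = \sum_(k <- msupp f) lmonom (lcoef k f) k.
Proof. exact: monalgE. Qed.

Lemma lmul_suml (I : Type) (r : seq I) (F : I -> laurent) g :
  lmul (\sum_(i <- r) F i) g = \sum_(i <- r) lmul (F i) g.
Proof. exact: (big_morph (lmul^~ g) (fun f1 f2 => lmulDl f1 f2 g) (lmul0l g)). Qed.

Lemma lmul_sumr (I : Type) (r : seq I) (F : I -> laurent) g :
  lmul g (\sum_(i <- r) F i) = \sum_(i <- r) lmul g (F i).
Proof. exact: (big_morph (lmul g) (lmulDr g) (lmul0r g)). Qed.

Lemma lmulA : associative lmul.
Proof.
move=> f g h; rewrite (laurentE f) (laurentE g) (laurentE h).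
rewrite lmul_suml (lmul_suml (msupp f)) [RHS]lmul_suml.
apply: eq_bigr => i _.
rewrite lmul_suml [LHS]lmul_sumr (lmul_sumr (msupp g)) [RHS]lmul_suml.
apply: eq_bigr => j _; rewrite !(lmul_sumr (msupp h)) /=.
by apply: eq_bigr => k _; rewrite !lmonomM mulrA addrA.
Qed.

Lemma lmul1l : left_id (lmonom 1 0) lmul.
Proof.
move=> f; rewrite {1}(laurentE f) lmul_sumr [RHS]laurentE.
by apply: eq_bigr => k _; rewrite lmonomM mul1r add0r.
Qed.

Lemma lone_neq0 : lmonom 1 0 != 0 :> laurent.
Proof.
by apply/eqP => /(congr1 (lcoef 0)); rewrite /lcoef mcoeffUU mcoeff0.
Qed.

End LaurentRing.

HB.instance Definition _ := GRing.Zmodule_isComNzRing.Build laurent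
  lmulA lmulC lmul1l lmulDl lone_neq0.

Notation Z2 := (int * int)%type.

(* The unit square [i, i+1] x [j, j+1] is represented by its corner (i, j). *)
Definition black (s : Z2) : bool := (2 %| s.1 + s.2)%Z.

Definition unit_vectors : seq Z2 := [:: (-1, 0); (0, 1); (1, 0); (0, -1)].

Definition share_side (s s' : Z2) : bool := s' - s \in unit_vectors.

(* Two squares sharing a side have opposite colours, so a domino is encoded by
   the pair (its black square, its white square); the same pair encodes the
   corresponding edge of the graph of centres of squares. *)
Definition domino (e : Z2 * Z2) : bool :=
  [&& black e.1, ~~ black e.2 & share_side e.1 e.2].

Definition covers (e : Z2 * Z2) (s : Z2) : Prop := s = e.1 \/ s = e.2.

(* Dominoes being unions of unit squares, disjoint interiors means that no unit
   square is shared, and covering the plane means covering every square. *)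
Definition is_tiling (t : set (Z2 * Z2)) : Prop :=
  [/\ forall e, t e -> domino e,
      forall e e', t e -> t e' -> e <> e' -> forall s, ~ (covers e s /\ covers e' s)
    & forall s, exists2 e, t e & covers e s].

Definition translate (v : Z2) (e : Z2 * Z2) : Z2 * Z2 := (e.1 + v, e.2 + v).

Definition even_sublattice (v : Z2) : bool := (2 %| v.1)%Z && (2 %| v.2)%Z.

Definition odd_coset (v : Z2) : bool := even_sublattice (v - (1, 1)).

Definition valid_lattice (L : set Z2) : Prop :=
  exists v w : Z2,
    [/\ even_sublattice v || odd_coset v, even_sublattice w || odd_coset w,
        v.1 * w.2 - v.2 * w.1 != 0
      & forall u, L u <-> exists m n : int, u = v *~ m + w *~ n].

Definition periodic (L : set Z2) (t : set (Z2 * Z2)) : Prop :=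
  forall v, L v -> forall e, t e <-> t (translate v e).

(* [clockwise_side s s' u u']: the segment from u to u' is the common side of
   the squares s and s', traversed clockwise around s. Hence s lies to the
   right and s' to the left of the oriented segment. *)
Definition clockwise_side (s s' u u' : Z2) : bool :=
  (s', u, u') \in
    [:: (s + (-1, 0), s,          s + (0, 1));
        (s + (0, 1),  s + (0, 1), s + (1, 1));
        (s + (1, 0),  s + (1, 1), s + (1, 0));
        (s + (0, -1), s + (1, 0), s)].

Definition is_height (t : set (Z2 * Z2)) (h : Z2 -> int) : Prop :=
  h 0 = 0 /\
  forall s s' u u', black s -> clockwise_side s s' u u' ->
    (~ t (s, s') -> h u' = h u + 1) /\ (t (s, s') -> h u' = h u - 3).

Definition dot (R : realType) (f : R * R) (v : Z2) : R :=
  f.1 * v.1%:~R + f.2 * v.2%:~R.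

Definition is_flux (R : realType) (L : set Z2) (t : set (Z2 * Z2))
    (phi : R * R) : Prop :=
  exists2 h, is_height t h &
    forall v, L v -> forall u, 4 * dot phi v = (h (u + v) - h u)%:~R.

Definition flux_set (R : realType) (L : set Z2) : set (R * R) :=
  fun phi => exists t, [/\ is_tiling t, periodic L t & is_flux L t phi].

Definition dual_lattice (R : realType) (L : set Z2) : set (R * R) :=
  fun f => forall v, L v -> dot f v \is a Num.int.

Definition dual_basis (R : realType) (L : set Z2) (f g : R * R) : Prop :=
  (forall a, dual_lattice L a <-> exists m n : int, a = f *~ m + g *~ n) /\
  (forall m n : int, f *~ m + g *~ n = 0 -> m = 0 /\ n = 0).

Definition flux_connecting_basis (R : realType) (L : set Z2)
    (f g : R * R) : Prop :=
  dual_basis L f g /\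
  forall phi psi : R * R, flux_set L phi -> flux_set L psi ->
    exists p : seq (R * R),
      [/\ forall a, a \in p -> flux_set L a,
          path (fun a c => c - a \in [:: f; - f; g; - g]) phi p
        & last phi p = psi].

(* (x0, 0) and (x1, y1) are the distinguished generators of L. *)
Definition lattice_frame (L : set Z2) (x0 x1 y1 : int) : Prop :=
  [/\ [/\ 0 < x0, L (x0, 0) & forall x, 0 < x -> L (x, 0) -> x0 <= x],
      [/\ 0 < y1, exists x, L (x, y1)
        & forall x y, 0 < y -> L (x, y) -> y1 <= y]
    & 0 <= x1 < x0 /\ L (x1, y1)].

Definition in_rectangle (x0 y1 : int) (s : Z2) : bool :=
  (0 <= s.1 < x0) && (0 <= s.2 < y1).

Definition enumerates (m : nat) (b : 'I_m -> Z2) (P : Z2 -> bool) : Prop :=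
  injective b /\ forall s, P s <-> exists i, b i = s.

(* The oriented unit steps of the lattice paths (0,0) -> (x0,0) and
   (0,0) -> (0,y1) -> (x1,y1). *)
Definition u0_step (x0 : int) (u u' : Z2) : bool :=
  [&& u.2 == 0, 0 <= u.1 < x0 & u' == u + (1, 0)].

Definition u1_step (x1 y1 : int) (u u' : Z2) : bool :=
  [&& u.1 == 0, 0 <= u.2 < y1 & u' == u + (0, 1)] ||
  [&& u.2 == y1, 0 <= u.1 < x1 & u' == u + (1, 0)].

(* Some edge in the orbit of e crosses the path with oriented unit steps [step],
   its black endpoint lying to the left of the path: the segment is
   traversed clockwise around the white square. *)
Definition crosses_black_left (L : set Z2) (step : Z2 -> Z2 -> bool)
    (e : Z2 * Z2) : Prop :=
  exists v u u', [/\ L v, step u u'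
    & clockwise_side (translate v e).2 (translate v e).1 u u'].

Definition crosses_black_right (L : set Z2) (step : Z2 -> Z2 -> bool)
    (e : Z2 * Z2) : Prop :=
  exists v u u', [/\ L v, step u u'
    & clockwise_side (translate v e).1 (translate v e).2 u u'].

Definition crossing_exponent (L : set Z2) (step : Z2 -> Z2 -> bool)
    (e : Z2 * Z2) : int :=
  (`[< crosses_black_left L step e >] : nat)%:Z
  - (`[< crosses_black_right L step e >] : nat)%:Z.

Definition edge_sign (e : Z2 * Z2) : int := if e.2 == e.1 + (1, 0) then -1 else 1.

Definition orbit_weight (L : set Z2) (x0 x1 y1 : int) (e : Z2 * Z2) : laurent :=
  lmonom (edge_sign e) (crossing_exponent L (u0_step x0) e,
                        crossing_exponent L (u1_step x1 y1) e).

(* Every orbit of edges joining translates of b_i and w_j contains exactly one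
   edge whose black endpoint is b_i itself; the sum runs over these edges. *)
Definition kasteleyn (L : set Z2) (x0 x1 y1 : int) (m : nat)
    (b w : 'I_m -> Z2) : 'M[laurent]_m :=
  \matrix_(i, j) \sum_(d <- unit_vectors | `[< L (b i + d - w j) >])
     orbit_weight L x0 x1 y1 (b i, b i + d).

(* On fluxes, <phi, (x0, 0)> is an integer, and <phi, (x1, y1)> is an integer
   or a half-integer according to the parity class of (x1, y1), so the floors
   below are exact. *)
Definition flux_monomial (R : realType) (x0 x1 y1 : int) (phi : R * R) : Z2 :=
  (Num.floor (dot phi (x0, 0)),
   Num.floor (if even_sublattice (x1, y1) then dot phi (x1, y1)
              else dot phi (x1, y1) - 2^-1)).

Definition flux_sign (R : realType) (L : set Z2) (x0 x1 y1 : int) (m : nat)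
    (b w : 'I_m -> Z2) (phi : R * R) : rat :=
  (sgz (lcoef (flux_monomial x0 x1 y1 phi)
              (\det (kasteleyn L x0 x1 y1 b w))))%:~R.

(* Main.v *)
Require Import Defs.
From mathcomp Require Import all_boot all_order all_algebra.
From mathcomp Require Import all_fingroup.
From mathcomp Require Import finmap.
From mathcomp.multinomials Require Import monalg.
From mathcomp Require Import boolp classical_sets reals.
From mathcomp Require Import zify ring lra.

(* Compare a tiling t of the torus with the brick wall of dominoes (b, b + (1, 0)).
   Sending a black square to the one whose right neighbour completes its domino
   in t gives a permutation pi of the black squares of the torus, every non-fixed
   step of which goes strictly to the left. Let g = (h_t - h_0) / 4, where h_0 is
   the height of the brick wall. On the lifts to the plane, g (at the lower right
   corner of the square) is constant along pi and, by monotonicity along columns,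
   separates the non-trivial orbits; so on the torus these are counted by the
   generator of the group g(u + L) - g(u), that is, by gcd (s_0, s_1), where s_k
   is the increment of g along v_k. The Kasteleyn signs are -1 exactly at the
   fixed points of pi, hence the term of det K is, up to a global sign, 1 if s_0
   and s_1 are both even and -1 otherwise. As (s_0, s_1) is affine in the flux and
   a basis of L^* has an odd determinant in the coordinates given by v_0 and v_1,
   of the four fluxes of a parallelogram exactly one has both coordinates even. *)

Set Implicit Arguments.
Unset Strict Implicit.
Unset Printing Implicit Defensive.

Import Order.TTheory GRing.Theory Num.Theory.

Local Open Scope ring_scope.

(** * Induction, antidifferences and telescoping over the integers *)

Lemma int_bi_ind (P : int -> Prop) :
  P 0 -> (forall n : int, P n <-> P (n + 1)) -> forall n, P n.
Proof.
move=> P0 PS; elim/int_ind => // n Pn; first by rewrite -addn1 PoszD -PS.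
by apply/PS; rewrite -addn1 PoszD opprD addrNK.
Qed.

Lemma antidifference (f : int -> int) :
  exists2 F : int -> int, F 0 = 0 & forall x : int, F (x + 1) = F x + f x.
Proof.
exists (fun x => match x with
  | Posz n => \sum_(k < n) f k%:Z
  | Negz n => - \sum_(k < n.+1) f (- (k.+1)%:Z) end); first exact: big_ord0.
case=> [n|[|n]].
- by rewrite -PoszD addn1 big_ord_recr.
- by rewrite big_ord_recl big_ord0 addr0 /= big_ord0 addNr.
have -> : Negz n.+1 + 1 = Negz n by lia.
by rewrite [in RHS]big_ord_recr /= NegzE opprD addrNK.
Qed.

Lemma telescope_nat (F f : int -> int) (n : nat) :
  (forall x : int, F (x + 1) = F x + f x) -> F n%:Z = F 0 + \sum_(k < n) f k%:Z.
Proof.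
move=> Ff; elim: n => [|n IHn]; first by rewrite big_ord0 addr0.
by rewrite big_ord_recr /= addrA -IHn -Ff -PoszD addn1.
Qed.

Lemma constant_of_increments (F : int -> int -> int) :
  (forall x y : int, F (x + 1) y = F x y) ->
  (forall x y : int, F x (y + 1) = F x y) ->
  forall x y, F x y = F 0 0.
Proof.
move=> Fx Fy x y.
have -> : F x y = F x 0 by elim/int_bi_ind: y => // n; rewrite Fy.
by elim/int_bi_ind: x => // n; rewrite Fx.
Qed.

(** * Matchings of the plane and their level functions *)

(* [D x y] is the displacement from the black square (x, y) to the white square
   it is matched with; the values of [D] at white squares are irrelevant. *)
Definition ind (D : int -> int -> Z2) (d : Z2) (x y : int) : int :=
  ((D x y == d) : nat)%:Z.

(** Since [D] only has a meaning at black squares, a white square is constrained through the four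
    black neighbours that may point at it. Integer sums make both conditions usable in linear
    arithmetic. *)
Definition perfect (D : int -> int -> Z2) : Prop :=
  (forall x y : int, (2 %| x + y)%Z ->
     ind D (-1, 0) x y + ind D (0, 1) x y + ind D (1, 0) x y
     + ind D (0, -1) x y = 1) /\
  (forall x y : int, ~~ (2 %| x + y)%Z ->
     ind D (-1, 0) (x + 1) y + ind D (0, 1) x (y - 1) + ind D (1, 0) (x - 1) y
     + ind D (0, -1) x (y + 1) = 1).

(* The increments of (h - h0) / 4, where h is the height function of the tiling
   and h0 that of the brick wall made of the dominoes (b, b + (1, 0)). *)
Definition dlevel_x (D : int -> int -> Z2) (x y : int) : int :=
  if (2 %| x + y)%Z then ind D (0, -1) x y else - ind D (0, 1) x (y - 1).

Definition dlevel_y (D : int -> int -> Z2) (x y : int) : int :=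
  if (2 %| x + y)%Z then - ind D (-1, 0) x y else ind D (1, 0) (x - 1) y - 1.

Definition is_level (D : int -> int -> Z2) (g : int -> int -> int) : Prop :=
  (forall x y : int, g (x + 1) y = g x y + dlevel_x D x y) /\
  (forall x y : int, g x (y + 1) = g x y + dlevel_y D x y).

Lemma ind_ge0 D d x y : 0 <= ind D d x y <= 1.
Proof. by rewrite /ind; case: eqP. Qed.

Lemma ind1 D d x y : D x y = d -> ind D d x y = 1.
Proof. by rewrite /ind => ->; rewrite eqxx. Qed.

Lemma ind0 D d x y : D x y != d -> ind D d x y = 0.
Proof. by rewrite /ind => /negbTE ->. Qed.

Lemma dlevel_y_cases D (x y : int) : dlevel_y D x y = 0 \/ dlevel_y D x y = -1.
Proof.
rewrite /dlevel_y; have := ind_ge0 D (-1, 0) x y.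
by have := ind_ge0 D (1, 0) (x - 1) y; case: ifP => _; lia.
Qed.

(** The circulation of the increments around a unit square is, up to sign, the number of dominoes
    covering that square minus one. *)
Lemma dlevel_curl D (x y : int) : perfect D ->
  dlevel_x D x y + dlevel_y D (x + 1) y = dlevel_y D x y + dlevel_x D x (y + 1).
Proof.
move=> [Db Dw]; rewrite /dlevel_x /dlevel_y !addrK.
have [b|b] := boolP (2 %| x + y)%Z; first have := Db _ _ b.
  have -> : (2 %| x + 1 + y)%Z = false by lia.
  have -> : (2 %| x + (y + 1))%Z = false by lia.
  lia.
have := Dw _ _ b.
have -> : (2 %| x + 1 + y)%Z by lia.
have -> : (2 %| x + (y + 1))%Z by lia.
lia.
Qed.

Lemma level_exists D : perfect D -> exists g, is_level D g.
Proof.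
move=> Dp; have [A _ AS] := antidifference (dlevel_x D ^~ 0).
have [C C0 CS] : exists2 C : int -> int -> int, forall x, C x 0 = 0
    & forall x y : int, C x (y + 1) = C x y + dlevel_y D x y.
  have /choice [C CP] x : exists C : int -> int,
      C 0 = 0 /\ forall y : int, C (y + 1) = C y + dlevel_y D x y.
    by have [C C0 CS] := antidifference (dlevel_y D x); exists C.
  by exists C => x; case: (CP x).
exists (fun x y => A x + C x y); split=> x y; last by rewrite CS addrA.
(* The horizontal increments are right on the row [y = 0] by the choice of [A]; [dlevel_curl]
   carries them from one row to the next, in both directions. *)
suff : A (x + 1) + C (x + 1) y - (A x + C x y) - dlevel_x D x y = 0 by lia.
elim/int_bi_ind: y => [|y]; first by rewrite !C0 AS; lia.
by have := dlevel_curl x y Dp; rewrite !CS; split; lia.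
Qed.

Lemma level_column_le D g (x y y' : int) : is_level D g -> y <= y' -> g x y' <= g x y.
Proof.
move=> [_ gy] le_yy'; have -> : y' = y + (`|y' - y|%N)%:Z by lia.
elim: (`|y' - y|%N) => [|n IHn]; first by rewrite addr0.
have -> : y + n.+1%:Z = y + n%:Z + 1 by lia.
by rewrite gy; have := dlevel_y_cases D x (y + n%:Z); lia.
Qed.

Lemma level_descent_unique D g (x y y' : int) : is_level D g ->
  g x (y + 1) < g x y -> g x (y' + 1) < g x y' -> g x y = g x y' -> y = y'.
Proof.
move=> gl gy gy' E.
have [lt_yy'|] := boolP (y + 1 <= y').
  have := level_column_le x gl lt_yy'; lia.
have [lt_yy'|] := boolP (y' + 1 <= y); last by lia.
have := level_column_le x gl lt_yy'; lia.
Qed.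

(** A discrete intermediate value argument: as [s < 0], quasi-periodicity makes [c] unbounded on
    both sides, and steps of 0 or -1 cannot skip the value [k]. *)
Lemma descent_exists (c : int -> int) (Y : int) (k : int) :
  0 < Y -> (forall y : int, c (y + 1) = c y \/ c (y + 1) = c y - 1) ->
  (exists2 s : int, s < 0 & forall y : int, c (y + Y) = c y + s) ->
  exists y, c y = k /\ c (y + 1) = k - 1.
Proof.
move=> Y0 c1 [s s0 cY].
have cYn (n y : int) : c (y + Y * n) = c y + s * n.
  elim/int_bi_ind: n y => [|n]; first by move=> y; rewrite !mulr0 !addr0.
  have E (y : int) : c (y + Y * (n + 1)) = c (y + Y * n) + s.
    by rewrite -cY; congr c; ring.
  by split=> H y; have := H y; have := E y; lia.
have far (K : int) : 0 <= K -> K <= s * - K /\ s * K <= - K.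
  by move=> K0; have : 0 <= (- 1 - s) * K by [apply: mulr_ge0; lia]; lia.
have [y0 y0k] : exists y : int, k <= c y.
  have [K [K0 KK]] : exists K : int, 0 <= K /\ k - c 0 <= K.
    by exists `|k - c 0|; lia.
  exists (Y * - K); have := cYn (- K) 0; rewrite add0r => ->.
  by have [] := far K K0; lia.
have [n cn] : exists n : nat, c (y0 + n%:Z) < k.
  have [K [K0 KK]] : exists K : int, 0 <= K /\ c y0 - k < K.
    by exists (`|c y0 - k| + 1); lia.
  exists `|(Y * K)%R|%N; rewrite gez0_abs ?mulr_ge0 ?cYn //; last exact: ltW.
  by have [_] := far K K0; lia.
(* Going down from [n] to the first place where [c] is below [k]; the value just before it is
   [k]. *)
elim: n cn => [|n IHn] cn; first by rewrite addr0 in cn; lia.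
have [lt_k|ge_k] := boolP (c (y0 + n) < k); first exact: IHn.
exists (y0 + n%:Z); have E : y0 + n%:Z + 1 = y0 + n.+1%:Z by lia.
by case: (c1 (y0 + n%:Z)); rewrite E; lia.
Qed.

(** * The leftward walk on black squares *)

Definition next_square (D : int -> int -> Z2) (s : Z2) : Z2 :=
  (s.1 + (D s.1 s.2).1 - 1, s.2 + (D s.1 s.2).2).

(** These are the black squares moved by [next_square]: a displacement [(1, 0)] is a domino of the
    brick wall and gives a fixed square. *)
Definition mobile (D : int -> int -> Z2) (s : Z2) : bool :=
  (2 %| s.1 + s.2)%Z && (D s.1 s.2 != (1, 0)).

Lemma mobile_displacement D x y : perfect D -> mobile D (x, y) ->
  [\/ D x y = (-1, 0), D x y = (0, 1) | D x y = (0, -1)].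
Proof.
move=> [Db _] /andP[/Db]; rewrite /ind /=.
have [E|N1] := eqVneq (D x y) (-1, 0); first by constructor 1.
have [E|N2] := eqVneq (D x y) (0, 1); first by constructor 2.
have [E|N3] := eqVneq (D x y) (0, -1); first by constructor 3.
by case: (_ == (1, 0)).
Qed.

(** The right side of a mobile square is crossed by a brick but not by a domino of the matching, so
    the level drops along it. *)
Lemma mobile_descent D g (x y : int) : perfect D -> is_level D g -> mobile D (x, y) ->
  g (x + 1) (y + 1) = g (x + 1) y - 1.
Proof.
move=> Dp [_ gy] /andP[/= b nr]; rewrite gy /dlevel_y addrK.
have -> : (2 %| x + 1 + y)%Z = false by lia.
by rewrite (ind0 nr) add0r.
Qed.

(** The white square matched to [(x, y)] has no other partner; in particular the black square on its
    left is not matched to it, and so is mobile. Between the two lower right corners the level does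
    not change when the domino points left; when it points up or down, a horizontal increment is
    offset by the descent beside a mobile square. *)
Lemma next_square_level D g (x y : int) (s := next_square D (x, y)) :
  perfect D -> is_level D g -> mobile D (x, y) ->
  mobile D s /\ g (s.1 + 1) s.2 = g (x + 1) y.
Proof.
move=> Dp gl m; have [b _] := andP m; rewrite /= in b.
have [Db Dw] := Dp; have [gx gy] := gl.
have desc := mobile_descent Dp gl m.
have [E|E|E] := mobile_displacement Dp m; rewrite /s /next_square /mobile /= E /=.
- have B : (2 %| x - 1 - 1 + (y + 0))%Z by lia.
  rewrite B addr0 subrK.
  have W := Dw (x - 1) y; have {W} := W ltac:(lia).
  rewrite subrK (ind1 E) => W.
  split.
    apply/negP => /eqP /ind1 F; rewrite F in W.
    have := ind_ge0 D (0, 1) (x - 1) (y - 1).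
    by have := ind_ge0 D (0, -1) (x - 1) (y + 1); lia.
  have := gx (x - 1) y; have := gx x y; rewrite /dlevel_x b.
  have -> : (2 %| x - 1 + y)%Z = false by lia.
  rewrite subrK [ind D (0, -1) x y]ind0 ?E //.
  have := ind_ge0 D (0, 1) (x - 1) (y - 1).
  have := ind_ge0 D (1, 0) (x - 1 - 1) y.
  by have := ind_ge0 D (0, -1) (x - 1) (y + 1); lia.
- have B : (2 %| x + 0 - 1 + (y + 1))%Z by lia.
  rewrite B addr0 subrK.
  have W := Dw x (y + 1); have {W} := W ltac:(lia).
  rewrite addrK (ind1 E) => W.
  split.
    apply/negP => /eqP /ind1 F; rewrite F in W.
    have := ind_ge0 D (-1, 0) (x + 1) (y + 1).
    by have := ind_ge0 D (0, -1) x (y + 1 + 1); lia.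
  have := gx x (y + 1); rewrite /dlevel_x.
  have -> : (2 %| x + (y + 1))%Z = false by lia.
  by rewrite addrK (ind1 E); lia.
have B : (2 %| x + 0 - 1 + (y - 1))%Z by lia.
rewrite B addr0 subrK.
have W := Dw x (y - 1); have {W} := W ltac:(lia).
rewrite subrK (ind1 E) => W.
have F : D (x - 1) (y - 1) != (1, 0).
  apply/negP => /eqP /ind1 F; rewrite F in W.
  have := ind_ge0 D (-1, 0) (x + 1) (y - 1).
  by have := ind_ge0 D (0, 1) x (y - 1 - 1); lia.
split=> //.
have := gx x y; rewrite /dlevel_x b (ind1 E).
have := gy x (y - 1); rewrite /dlevel_y.
have -> : (2 %| x + (y - 1))%Z = false by lia.
by rewrite subrK (ind0 F); lia.
Qed.

(** The displacement is recorded in the second case, the only one in which the walk skips a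
    column. *)
Lemma next_square_left D s : perfect D -> mobile D s ->
  (next_square D s).1 = s.1 - 1 \/
  (next_square D s).1 = s.1 - 2 /\ D s.1 s.2 = (-1, 0).
Proof.
case: s => x y Dp m; rewrite /next_square /=.
have [->|->|->] := mobile_displacement Dp m => /=; [right|left|left]; try lia.
by split=> //; lia.
Qed.

(* The level is monotone along columns, so it takes each of its descents at most
   once there: two mobile squares of the same level lie on one leftward path. *)
Lemma same_level_reach D g s s' : perfect D -> is_level D g ->
  mobile D s -> mobile D s' -> g (s.1 + 1) s.2 = g (s'.1 + 1) s'.2 ->
  s'.1 <= s.1 -> exists k, iter k (next_square D) s = s'.
Proof.
move=> Dp gl; have [n] := ubnP (`|s.1 - s'.1|%N).
elim: n s => // n IHn s lt_n ms ms' E le_s.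
have desc' := mobile_descent (x := s'.1) (y := s'.2) Dp gl ltac:(by case: (s') ms').
have desc := mobile_descent (x := s.1) (y := s.2) Dp gl ltac:(by case: (s) ms).
have [E1|N1] := eqVneq s.1 s'.1.
  exists 0%N => /=; rewrite [s]surjective_pairing [s']surjective_pairing E1.
  congr pair; rewrite -E1 in E desc'.
  by apply: (level_descent_unique (x := s.1 + 1) gl) => //; lia.
have [mn En] := next_square_level (x := s.1) (y := s.2) Dp gl
  ltac:(by case: (s) ms); rewrite -surjective_pairing in mn En.
have le_n : s'.1 <= (next_square D s).1.
  have [->|[-> Ds]] := next_square_left Dp ms; first lia.
  (* The walk overshoots only if it skips the column of [s']. Then the left side of [s] and the
     right side of [s'] are descents from the same level in one column, so both squares are at the
     same height, and being adjacent they cannot both be black. *)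
  suff : s'.1 + 1 != s.1 by lia.
  apply/eqP => E1; rewrite E1 in E desc'.
  have [gx gy] := gl; have b : (2 %| s.1 + s.2)%Z by case/andP: ms.
  have Ex := gx s.1 s.2; have Ey := gy s.1 s.2.
  rewrite /dlevel_x /dlevel_y b /ind Ds /= in Ex Ey.
  have E2 : s.2 = s'.2 by apply: (level_descent_unique (x := s.1) gl); lia.
  by case/andP: ms' => /=; lia.
have lt_n1 : (`|(next_square D s).1 - s'.1|%R < n%:Z).
  by have [|[]] := next_square_left Dp ms; lia.
have [k <-] := IHn (next_square D s) ltac:(lia) mn ms' (etrans En E) le_n.
by exists k.+1; rewrite iterSr.
Qed.

(** * The lattice and its fundamental rectangle *)

Lemma mulrz_pair (a c n : int) : (a, c) *~ n = (a * n, c * n) :> Z2.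
Proof.
elim/int_ind: n => [|n IHn|n IHn]; first by rewrite !mulr0.
  by rewrite -addn1 PoszD mulrzDr IHn !mulrDr !mulr1.
by rewrite -addn1 PoszD opprD mulrzDr IHn !mulrDr !mulrN1.
Qed.

(** Two Euclidean divisions: the minimality of [y1] kills the remainder of the second coordinate,
    then that of [x0] kills the remainder of the first. *)
Lemma frame_lattice (L : set Z2) (x0 x1 y1 : int) :
  valid_lattice L -> lattice_frame L x0 x1 y1 ->
  forall v, L v <-> exists m n : int, v = (x0 * m + x1 * n, y1 * n).
Proof.
move=> [p [q [_ _ _ Lpq]]] [[x0_gt0 L0 x0_min] [y1_gt0 _ y1_min] [_ L1]].
have LD u v (n : int) : L u -> L v -> L (u + v *~ n).
  move=> /Lpq[a [c ->]] /Lpq[a' [c' ->]]; apply/Lpq.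
  exists (a + a' * n), (c + c' * n).
  by rewrite mulrzDl -!mulrzA !mulrzDr [LHS]addrACA.
have L00 : L 0 by apply/Lpq; exists 0, 0; rewrite !mulr0z addr0.
move=> [a c]; split=> [Lv|[m [n ->]]]; last first.
  have := LD _ _ n (LD _ _ m L00 L0) L1; rewrite !mulrz_pair add0r mul0r.
  by congr (L (_, _)); rewrite /= add0r.
set n := (c %/ y1)%Z; have := LD _ _ (- n) Lv L1; rewrite mulrz_pair.
have -> : (a, c) + (x1 * - n, y1 * - n) = (a - x1 * n, (c %% y1)%Z) :> Z2.
  by congr pair; rewrite /= 1?{1}(divz_eq c y1) -/n; ring.
move=> Lr; have cE : c = y1 * n.
  have := modz_ge0 c (lt0r_neq0 y1_gt0); have := ltz_pmod c y1_gt0.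
  by have := divz_eq c y1; rewrite -/n; have := y1_min _ _ _ Lr; lia.
have c0 : (c %% y1)%Z = 0 by have := divz_eq c y1; rewrite -/n; lia.
rewrite c0 in Lr; set k := ((a - x1 * n)%R %/ x0)%Z.
have := LD _ _ (- k) Lr L0; rewrite mulrz_pair.
have -> : (a - x1 * n, 0) + (x0 * - k, 0 * - k) = (((a - x1 * n)%R %% x0)%Z, 0) :> Z2.
  congr pair; rewrite /= ?mul0r //.
  by rewrite {1}(divz_eq (a - x1 * n) x0) -/k; ring.
move=> Lr'; exists k, n; congr pair => //.
have := modz_ge0 (a - x1 * n) (lt0r_neq0 x0_gt0).
have := ltz_pmod (a - x1 * n) x0_gt0.
have := divz_eq (a - x1 * n) x0; rewrite -/k.
by have := x0_min _ _ Lr'; lia.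
Qed.

(** A system of representatives modulo [L] of the squares satisfying [P]; this is the form in which
    the enumerations of the rectangle are used below. *)
Definition transversal (L : set Z2) (m : nat) (b : 'I_m -> Z2)
    (P : Z2 -> bool) : Prop :=
  [/\ forall i, P (b i), forall s, P s -> exists i, L (s - b i)
    & forall i j, L (b i - b j) -> i = j].

Lemma frame_transversal (L : set Z2) (x0 x1 y1 : int) (m : nat)
    (b : 'I_m -> Z2) (P : Z2 -> bool) :
  lattice_frame L x0 x1 y1 ->
  (forall v, L v <-> exists m n : int, v = (x0 * m + x1 * n, y1 * n)) ->
  (forall s v, L v -> P (s + v) = P s) ->
  enumerates b (fun s => in_rectangle x0 y1 s && P s) -> transversal L b P.
Proof.
move=> [[x0_gt0 _ _] [y1_gt0 _ _] _] LE PL [b_inj bP]; split.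
- by move=> i; have /andP[] : in_rectangle x0 y1 (b i) && P (b i) by apply/bP; exists i.
- move=> [a c] Ps; pose n := (c %/ y1)%Z; pose k := ((a - x1 * n)%R %/ x0)%Z.
  pose v : Z2 := (x0 * k + x1 * n, y1 * n); have Lv : L v by apply/LE; exists k, n.
  have LNv : L (- v).
    by apply/LE; exists (- k), (- n); congr pair; rewrite /=; ring.
  suff /bP[i Ei] : in_rectangle x0 y1 ((a, c) - v) && P ((a, c) - v).
    by exists i; rewrite Ei subKr.
  rewrite PL // Ps andbT /in_rectangle /=.
  have := modz_ge0 (a - x1 * n) (lt0r_neq0 x0_gt0).
  have := ltz_pmod (a - x1 * n) x0_gt0; have := divz_eq (a - x1 * n) x0.
  have := modz_ge0 c (lt0r_neq0 y1_gt0); have := ltz_pmod c y1_gt0.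
  by have := divz_eq c y1; rewrite -/n -/k; lia.
move=> i j /LE[k [n E]]; apply: b_inj.
have /andP[Ri _] : in_rectangle x0 y1 (b i) && P (b i) by apply/bP; exists i.
have /andP[Rj _] : in_rectangle x0 y1 (b j) && P (b j) by apply/bP; exists j.
move: Ri Rj E; rewrite /in_rectangle; case: (b i) (b j) => [x y] [x' y'] /= R R' [E1 E2].
have n0 : n = 0 by nia.
rewrite n0 in E1 E2; have k0 : k = 0 by nia.
by rewrite k0 in E1; congr pair; lia.
Qed.

(** * Counting the orbits of a permutation by labels *)

(** The points of [F] are singleton orbits, and outside [F] the orbits are the fibres of [l], which
    takes exactly the values below [n]. *)
Lemma card_porbits_labelled (T : finType) (p : {perm T}) (F : {set T})
    (n : nat) (l : T -> nat) :
  (forall x, x \in F -> p x = x) ->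
  (forall x, x \notin F -> (l x < n)%N) ->
  (forall x, x \notin F -> p x \notin F /\ l (p x) = l x) ->
  (forall x y, x \notin F -> y \notin F -> l x = l y -> y \in porbit p x) ->
  (forall k, (k < n)%N -> exists2 x, x \notin F & l x = k) ->
  #|porbits p| = (#|F| + n)%N.
Proof.
move=> Fp ln lp l_orb l_surj.
have orbF x : x \in F -> porbit p x = [set x].
  move=> xF; apply/setP => y; rewrite inE; apply/porbitP/eqP => [[k ->]|->].
    by elim: k => [|k IHk]; rewrite ?expg0 ?perm1 // expgSr permM IHk Fp.
  by exists 0%N; rewrite expg0 perm1.
have orbN x y : x \notin F -> y \in porbit p x -> y \notin F /\ l y = l x.
  move=> xF /porbitP[k ->]; elim: k => [|k [IH1 IH2]]; first by rewrite expg0 perm1.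
  by rewrite expgSr permM; have [-> ->] := lp _ IH1.
have /choice [r rP] (k : 'I_n) : exists x, x \notin F /\ l x = k.
  by have [x] := l_surj k (ltn_ord k); exists x.
(* One orbit is chosen for each label, through the representative [r k]. *)
have -> : porbits p = porbit p @: F :|: [set porbit p (r k) | k : 'I_n].
  apply/setP => X; rewrite finset.in_setU; apply/imsetP/orP.
    move=> [x _ ->]; have [xF|xF] := boolP (x \in F); [left|right].
      exact: imset_f.
    apply/imsetP; exists (Ordinal (ln _ xF)) => //.
    apply/eqP; rewrite eq_porbit_mem; apply: l_orb => //.
      by have [] := rP (Ordinal (ln _ xF)).
    by have [_ ->] := rP (Ordinal (ln _ xF)).
  by case=> /imsetP[x _ ->]; [exists x | exists (r x)].
rewrite cardsU.
have -> : porbit p @: F :&: [set porbit p (r k) | k : 'I_n] = finset.set0.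
  apply/setP => X; rewrite !inE; apply/negP => /andP[/imsetP[x xF ->] /imsetP[k _ E]].
  have [rk _] := rP k; have [] := orbN (r k) x rk; last by rewrite xF.
  by rewrite -E porbit_id.
rewrite cards0 subn0 card_in_imset; last first.
  by move=> x y xF yF; rewrite !orbF // => /set1_inj.
rewrite card_imset ?card_ord // => k k' E.
have [rk lk] := rP k; have [rk' lk'] := rP k'.
have [_ E'] : r k' \notin F /\ l (r k') = l (r k).
  by apply: orbN => //; rewrite E porbit_id.
by apply: val_inj; rewrite /= -lk -lk' E'.
Qed.

(** * The sign of a matching of the torus *)

Definition subgroup (L : set Z2) : Prop :=
  L 0 /\ forall u v, L u -> L v -> L (u - v).

Section TorusMatching.

Variables (L : set Z2) (m : nat) (b w : 'I_m -> Z2).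
Hypothesis Lsub : subgroup L.
Hypothesis Leven : forall v, L v -> (2 %| v.1 + v.2)%Z.
Hypothesis bT : transversal L b black.
Hypothesis wT : transversal L w (fun s => ~~ black s).

Lemma subgroup0 : L 0. Proof. by case: Lsub. Qed.

Lemma subgroupB u v : L u -> L v -> L (u - v).
Proof. by case: Lsub => _; apply. Qed.

Lemma subgroupN v : L v -> L (- v).
Proof. by move=> Lv; rewrite -sub0r; apply: subgroupB => //; apply: subgroup0. Qed.

Lemma subgroupD u v : L u -> L v -> L (u + v).
Proof. by move=> Lu Lv; rewrite -[v]opprK; apply: subgroupB => //; apply: subgroupN. Qed.

Lemma black_translate s v : L v -> black (s + v) = black s.
Proof. by move=> /Leven; rewrite /black /=; lia. Qed.

Lemma black_near s i : L (s - b i) -> black s.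
Proof.
have [bB _ _] := bT => Ls; have := bB i.
by rewrite -[s](subrK (b i)) addrC black_translate.
Qed.

Variables (sigma : 'S_m) (d : 'I_m -> Z2).
Hypothesis d_unit : forall i, d i \in unit_vectors.
Hypothesis d_sigma : forall i, L (b i + d i - w (sigma i)).

(** On a small torus several edges may join the same two squares, so [sigma] does not determine the
    matching and the displacements [d] are carried along with it. *)
Definition lifts (D : int -> int -> Z2) : Prop :=
  forall i x y, L ((x, y) - b i) -> D x y = d i.

Lemma lift_exists : exists D, lifts D.
Proof.
have [_ _ b_inj] := bT.
have /choice [D DP] (s : Z2) : exists e, forall i, L (s - b i) -> e = d i.
  have [[i Li]|N] := pselect (exists i, L (s - b i)); last first.
    by exists 0 => i Li; case: N; exists i.
  exists (d i) => j Lj; congr d; apply: b_inj.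
  by have := subgroupB Lj Li; rewrite opprB addrC subrKA.
by exists (fun x y => D (x, y)) => i x y; apply: DP.
Qed.

Variable D : int -> int -> Z2.
Hypothesis DL : lifts D.

Lemma lift_periodic x y v : L v -> black (x, y) ->
  D (x + v.1) (y + v.2) = D x y.
Proof.
move=> Lv bs; have [_ b_rep _] := bT; have [i Li] := b_rep _ bs.
rewrite (DL Li); apply: DL.
have -> : (x + v.1, y + v.2) - b i = (x, y) - b i + v by rewrite addrAC.
exact: subgroupD.
Qed.

Lemma ind_periodic e x y v : L v -> black (x, y) ->
  ind D e (x + v.1) (y + v.2) = ind D e x y.
Proof. by move=> Lv bs; rewrite /ind lift_periodic. Qed.

Lemma unit_vectors_sum e : e \in unit_vectors ->
  ((e == (-1, 0)) : nat)%:Z + ((e == (0, 1)) : nat)%:Z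
  + ((e == (1, 0)) : nat)%:Z + ((e == (0, -1)) : nat)%:Z = 1.
Proof. by rewrite !inE => /or4P[] /eqP ->. Qed.

Lemma lift_perfect : perfect D.
Proof.
have [bB b_rep b_inj] := bT; have [wW w_rep w_inj] := wT.
split=> x y.
  move=> bs; have [i Li] := b_rep (x, y) bs.
  by rewrite /ind (DL Li) unit_vectors_sum.
(* [P e] says that the white square is the partner of the neighbour from which [e] leads to it. Such
   an [e] exists because [sigma] is onto and is unique because [sigma] is injective. *)
move=> ws; pose P (e : Z2) := D (x - e.1) (y - e.2) == e.
have [e eu Pe] : exists2 e, e \in unit_vectors & P e.
  have [j Lj] := w_rep (x, y) ws; pose i := (sigma^-1)%g j.
  exists (d i) => //; apply/eqP; apply: DL.
  have -> : (x - (d i).1, y - (d i).2) - b i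
      = ((x, y) - w j) - (b i + d i - w j) by rewrite opprB addrA subrK opprD addrA addrAC.
  by apply: subgroupB => //; have := d_sigma i; rewrite permKV.
have P_inj e1 e2 : e1 \in unit_vectors -> e2 \in unit_vectors -> P e1 -> P e2 -> e1 = e2.
  have rep e' : e' \in unit_vectors -> P e' ->
      exists i, e' = d i /\ L ((x, y) - w (sigma i)).
    move=> e'u /eqP E.
    have [i Li] := b_rep (x - e'.1, y - e'.2) ltac:(
      by move: e'u ws; rewrite !inE /black => /or4P[] /eqP -> /=; lia).
    have E' := DL Li; rewrite E in E'; exists i; split=> //.
    have -> : (x, y) - w (sigma i)
        = ((x - e'.1, y - e'.2) - b i) + (b i + d i - w (sigma i)).
      by rewrite -E'; congr pair; rewrite /=; ring.
    exact: subgroupD.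
  move=> u1 u2 /(rep _ u1)[i [-> Li]] /(rep _ u2)[j [-> Lj]]; congr d.
  apply/(@perm_inj _ sigma)/w_inj.
  by have := subgroupB Lj Li; rewrite opprB addrC subrKA.
have nP e1 e2 : e1 \in unit_vectors -> e2 \in unit_vectors -> e1 != e2 ->
    ~~ (P e1 && P e2).
  by move=> u1 u2 /eqP ne; apply/negP => /andP[p q]; apply/ne/P_inj.
have n12 := nP (-1, 0) (0, 1) isT isT isT.
have n13 := nP (-1, 0) (1, 0) isT isT isT.
have n14 := nP (-1, 0) (0, -1) isT isT isT.
have n23 := nP (0, 1) (1, 0) isT isT isT.
have n24 := nP (0, 1) (0, -1) isT isT isT.
have n34 := nP (1, 0) (0, -1) isT isT isT.
have ex : [|| P (-1, 0), P (0, 1), P (1, 0) | P (0, -1)].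
  by move: eu Pe; rewrite !inE => /or4P[] /eqP -> ->; rewrite ?orbT.
rewrite /ind; move: ex n12 n13 n14 n23 n24 n34; rewrite /P /= !subr0 !opprK.
by do 4!case: (_ == _) => //=.
Qed.

Variable tau : 'S_m.
Hypothesis d_tau : forall i, L (b i + (1, 0) - w (tau i)).

(* Gluing each black square to its right neighbour turns the matching into a
   permutation of the black squares of the torus. *)
Let pi : 'S_m := (sigma * tau^-1)%g.

Lemma next_square_pi i s : L (s - b i) -> L (next_square D s - b (pi i)).
Proof.
move=> Ls; have Ds : D s.1 s.2 = d i by apply: DL; rewrite -surjective_pairing.
have -> : next_square D s - b (pi i)
    = (s - b i) + (b i + d i - w (sigma i)) - (b (pi i) + (1, 0) - w (tau (pi i))).
  rewrite /pi permM permKV /next_square Ds.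
  case: s (b _) (b _) (d _) (w _) {Ls Ds} => [s1 s2] [p1 p2] [q1 q2] [e1 e2] [w1 w2].
  by congr pair; rewrite /=; ring.
by apply: subgroupB => //; apply: subgroupD.
Qed.

Variable g : int -> int -> int.
Hypothesis gL : is_level D g.

Definition shift (v : Z2) : int := g v.1 v.2 - g 0 0.

(** Translations by [L] preserve colours and [D] at black squares, so the increments of [g] are
    periodic and [g] itself changes by a constant. *)
Lemma level_shift (x y : int) v : L v -> g (x + v.1) (y + v.2) = g x y + shift v.
Proof.
move=> Lv; have [gx gy] := gL; have v2 := Leven Lv.
suff : g (x + v.1) (y + v.2) - g x y = g (0 + v.1) (0 + v.2) - g 0 0.
  by rewrite !add0r /shift; lia.
move: x y; apply: (@constant_of_increments
  (fun x y : int => g (x + v.1) (y + v.2) - g x y)) => x y.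
  rewrite (addrAC x 1) !gx /dlevel_x.
  have -> : (2 %| x + v.1 + (y + v.2))%Z = (2 %| x + y)%Z by lia.
  case: ifP => bs; first by rewrite (ind_periodic _ Lv bs); ring.
  rewrite (addrAC y v.2) ind_periodic //; first by ring.
  by rewrite /black /=; lia.
rewrite (addrAC y 1) !gy /dlevel_y.
have -> : (2 %| x + v.1 + (y + v.2))%Z = (2 %| x + y)%Z by lia.
case: ifP => bs; first by rewrite (ind_periodic _ Lv bs); ring.
rewrite (addrAC x v.1) ind_periodic //; first by ring.
by rewrite /black /=; lia.
Qed.

Lemma shiftD u v : L u -> L v -> shift (u + v) = shift u + shift v.
Proof. by move=> Lu Lv; rewrite /shift level_shift // /shift; ring. Qed.

Variables x0 x1 y1 : int.
Hypothesis x0_gt0 : 0 < x0.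
Hypothesis y1_gt0 : 0 < y1.
Hypothesis LE : forall v, L v <-> exists k n : int, v = (x0 * k + x1 * n, y1 * n).

Let s0 := shift (x0, 0).
Let s1 := shift (x1, y1).

Lemma shift_frame (k n : int) : shift (x0 * k + x1 * n, y1 * n) = s0 * k + s1 * n.
Proof.
have L0 : L (x0, 0) by apply/LE; exists 1, 0; rewrite !mulr0 mulr1 addr0.
have L1 : L (x1, y1) by apply/LE; exists 0, 1; rewrite !mulr0 !mulr1 add0r.
have step v (F : int -> Z2) : L v -> (forall j, L (F j)) -> F 0 = 0 ->
    (forall j : int, F (j + 1) = F j + v) -> forall j : int, shift (F j) = shift v * j.
  move=> Lv LF F0 FS; elim/int_bi_ind => [|j].
    by rewrite F0 /shift subrr mulr0.
  rewrite FS shiftD // mulrDr mulr1; split=> [-> //|].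
  exact: addIr.
have -> : (x0 * k + x1 * n, y1 * n) = (x0 * k, 0) + (x1 * n, y1 * n) :> Z2.
  by congr pair; rewrite /= add0r.
have L0k (j : int) : L (x0 * j, 0) by apply/LE; exists j, 0; rewrite !mulr0 addr0.
have L1k (j : int) : L (x1 * j, y1 * j) by apply/LE; exists 0, j; rewrite !mulr0 add0r.
rewrite shiftD //; congr (_ + _).
  rewrite -/(shift (x0, 0)) (step (x0, 0) (fun j => (x0 * j, 0))) ?mulr0 //.
  by move=> j; congr pair; rewrite /= ?addr0 // mulrDr mulr1.
rewrite (step (x1, y1) (fun j => (x1 * j, y1 * j))) ?mulr0 //.
by move=> j; congr pair; rewrite /= mulrDr mulr1.
Qed.

Lemma shift_dvd v : L v -> (gcdz s0 s1 %| shift v)%Z.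
Proof.
by move=> /LE[k [n ->]]; rewrite shift_frame rpredD // dvdz_mulr ?dvdz_gcdl ?dvdz_gcdr.
Qed.

(** Bezout's identity; with [shift_dvd], the increments of the level along [L] are exactly the
    multiples of the gcd. *)
Lemma shift_gcd (c : int) : (gcdz s0 s1 %| c)%Z -> exists2 v, L v & shift v = c.
Proof.
move=> /dvdzP[q ->]; have [k [n <-]] := Bezoutz s0 s1.
exists (x0 * (k * q) + x1 * (n * q), y1 * (n * q)); first by apply/LE; exists (k * q), (n * q).
by rewrite shift_frame; ring.
Qed.

(** A vertical period is what makes monotonicity along columns applicable on the torus. *)
Lemma L_vertical : L (0, y1 * x0).
Proof. by apply/LE; exists (- x1), x0; congr pair; ring. Qed.

Lemma shift_vertical s : mobile D s -> shift (0, y1 * x0) < 0.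
Proof.
case: s => x y ms; have desc := mobile_descent lift_perfect gL ms.
have := level_shift (x + 1) y L_vertical; rewrite /= addr0.
have : y + 1 <= y + y1 * x0 by nia.
by move=> /(level_column_le (x + 1) gL); lia.
Qed.

Lemma gcd_shift_gt0 s : mobile D s -> 0 < gcdz s0 s1.
Proof.
move=> /shift_vertical neg; rewrite lt_def andbT.
by apply/eqP => E; have := shift_dvd L_vertical; rewrite E dvd0z => /eqP; lia.
Qed.

(** The matching is then the brick wall itself and its level is constant; the gcd is 0, in agreement
    with the absence of non-trivial orbits. *)
Lemma shift_immobile v : (forall s, ~~ mobile D s) -> shift v = 0.
Proof.
move=> nm; have D1 (x y : int) : (2 %| x + y)%Z -> D x y = (1, 0).
  by move=> bs; have := nm (x, y); rewrite /mobile /= bs /= negbK => /eqP.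
rewrite /shift; apply/eqP; rewrite subr_eq0; apply/eqP.
have [gx gy] := gL; apply: constant_of_increments => x y.
  rewrite gx /dlevel_x; case: ifP => bs; first by rewrite ind0 ?addr0 // D1.
  by rewrite ind0 ?oppr0 ?addr0 // D1 //; lia.
rewrite gy /dlevel_y; case: ifP => bs; first by rewrite ind0 ?oppr0 ?addr0 // D1.
by rewrite ind1 ?subrr ?addr0 // D1 //; lia.
Qed.

Definition label (s : Z2) : int := g (s.1 + 1) s.2.

Lemma label_translate s v : L v -> label (s + v) = label s + shift v.
Proof. by move=> Lv; rewrite /label /= -level_shift // addrAC. Qed.

Lemma mobile_translate s v : L v -> mobile D (s + v) = mobile D s.
Proof.
move=> Lv; rewrite /mobile -!/(black _) black_translate //.
case: s => x y; have [bs|//] := boolP (black (x, y)).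
by rewrite /= lift_periodic.
Qed.

(** The column [x = 1] falls by a non-zero amount along the vertical period, so it has a descent
    from every level, and each descent comes from a mobile square. *)
Lemma label_level_exists (k : int) s : mobile D s -> exists2 s', mobile D s' & label s' = k.
Proof.
move=> ms; have [gx gy] := gL.
have [y||y [yk yk1]] := @descent_exists (g 1) (y1 * x0) k (mulr_gt0 y1_gt0 x0_gt0).
- rewrite gy; have [->|->] := dlevel_y_cases D 1 y; [left|by right].
  by rewrite addr0.
- exists (shift (0, y1 * x0)); first exact: shift_vertical ms.
  by move=> y; rewrite -(level_shift 1 y L_vertical) /= addr0.
(* If the square left of the descent is black, it is the mobile square sought. Otherwise [(1, y)] is
   black and matched to its left, and its lower side has increment 0. *)
move: yk1; rewrite gy /dlevel_y; case: ifP => bs E; last first.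
  exists (0, y); last by rewrite /label /= add0r.
  rewrite /mobile /= add0r; apply/andP; split; first by lia.
  by apply/negP => /eqP F; move: E; rewrite subrr (ind1 F); lia.
have D1 : D 1 y = (-1, 0).
  by apply/eqP/negPn/negP => /ind0 F; rewrite F in E; lia.
exists (1, y); first by rewrite /mobile /= bs D1.
by rewrite /label /= gx /dlevel_x bs ind0 ?D1 // addr0.
Qed.

Let F := finset (fun i => d i == (1, 0)).

Lemma mobileE s i : L (s - b i) -> mobile D s = (i \notin F).
Proof.
move=> Ls; rewrite finset.in_set /mobile -/(black s) (black_near Ls) /=.
by rewrite (DL (x := s.1) (y := s.2) (i := i)) // -surjective_pairing.
Qed.

Lemma iter_next_square_pi i s k :
  L (s - b i) -> L (iter k (next_square D) s - b ((pi ^+ k)%g i)).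
Proof.
move=> Ls; elim: k => [|k IHk]; first by rewrite expg0 perm1.
by rewrite iterS expgSr permM; apply: next_square_pi.
Qed.

(** The non-trivial orbits are labelled by the level modulo the gcd, the level being defined on the
    torus only up to increments along [L]. *)
Lemma card_porbits_pi : #|porbits pi| = (#|F| + `|gcdz s0 s1|)%N.
Proof.
have [bB b_rep b_inj] := bT; have [wW w_rep w_inj] := wT.
have Lb i : L (b i - b i) by rewrite subrr; apply: subgroup0.
have mob i : i \notin F -> mobile D (b i) by rewrite -(mobileE (Lb i)).
pose l i := `|(label (b i) %% gcdz s0 s1)%Z|%N.
have lE (i : 'I_m) : i \notin F -> (l i)%:Z = (label (b i) %% gcdz s0 s1)%Z.
  by move=> /mob/gcd_shift_gt0/lt0r_neq0 n0; rewrite /l gez0_abs // modz_ge0.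
have near_label s i : L (s - b i) ->
    (label s = label (b i) %[mod gcdz s0 s1])%Z.
  move=> Ls; apply/eqP; rewrite eqz_mod_dvd.
  have := label_translate (b i) Ls; rewrite [b i + _]addrC subrK => ->.
  by rewrite addrC addKr shift_dvd.
apply: (card_porbits_labelled (l := l)) => [i|i iF|i iF|i j iF jF E|k lt_k].
- rewrite finset.in_set => /eqP di; rewrite /pi permM.
  suff -> : sigma i = tau i by rewrite permK.
  apply: w_inj; have := subgroupB (d_tau i) (d_sigma i).
  by rewrite di opprB addrC subrKA.
- have n0 := gcd_shift_gt0 (mob i iF).
  by rewrite -ltz_nat lE // gez0_abs ?ltz_pmod // ltW.
- have Ln := next_square_pi (Lb i); have mi := mob i iF.
  move: (mi); rewrite [b i]surjective_pairing.
  move=> /(next_square_level lift_perfect gL); rewrite -surjective_pairing.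
  move=> [mn En]; have piF : pi i \notin F by rewrite -(mobileE Ln).
  split=> //; apply/eqP; rewrite -eqz_nat !lE //; apply/eqP.
  by rewrite -(near_label _ _ Ln) /label En.
(* Translating one square by a suitable [v] turns congruent levels into equal ones; the square
   further right then walks to the other. *)
- have /shift_gcd[v Lv vE] : (gcdz s0 s1 %| label (b i) - label (b j))%Z.
    by rewrite -eqz_mod_dvd -!lE // E.
  have El : label (b j + v) = label (b i) by rewrite label_translate // vE; ring.
  have Lj : L (b j + v - b j) by rewrite addrC addKr.
  have mi := mob i iF.
  have mj : mobile D (b j + v) by rewrite mobile_translate // mob.
  have [le_ji|/ltW le_ij] := lerP (b j + v).1 (b i).1.
    have [k Ek] := same_level_reach lift_perfect gL mi mj (esym El) le_ji.
    have := iter_next_square_pi k (Lb i); rewrite Ek => Lk.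
    apply/porbitP; exists k; apply: b_inj.
    by have := subgroupB Lk Lv; rewrite addrAC addrK.
  have [k Ek] := same_level_reach lift_perfect gL mj mi El le_ij.
  have := iter_next_square_pi k Lj; rewrite Ek => Lk.
  by rewrite porbit_sym; apply/porbitP; exists k; apply: b_inj.
(* Without mobile squares the gcd would be 0, and no [k] would lie below it. *)
have [s ms] : exists s, mobile D s.
  have [//|nm] := pselect (exists s, mobile D s).
  have nm' s : ~~ mobile D s by apply/negP => ms; apply: nm; exists s.
  by move: lt_k; rewrite /s0 /s1 !shift_immobile.
have [s' ms' Es'] := label_level_exists k ms.
have bs' : black s' by case/andP: ms'.
have [i Li] := b_rep _ bs'; have iF : i \notin F by rewrite -(mobileE Li).
exists i => //; apply/eqP; rewrite -eqz_nat lE // -(near_label _ _ Li) Es'.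
apply/eqP/modz_small; have := gcd_shift_gt0 ms; lia.
Qed.

Lemma prod_edge_sign : \prod_i edge_sign (b i, b i + d i) = (-1) ^+ #|F| :> int.
Proof.
rewrite -prodr_const [RHS]big_mkcond; apply: eq_bigr => i _.
by rewrite finset.in_set /edge_sign /= (inj_eq (addrI _)).
Qed.

(** The parity of [pi] is that of [m] plus its number of orbits. The fixed points among these cancel
    against the edge signs, which leaves the parity of the gcd, even exactly when both increments
    are. *)
Lemma matching_sign :
  (-1) ^+ sigma * \prod_i edge_sign (b i, b i + d i)
  = (-1) ^+ tau * (-1) ^+ m
    * (if (2 %| s0)%Z && (2 %| s1)%Z then 1 else -1) :> int.
Proof.
have -> : (-1) ^+ sigma = (-1) ^+ pi * (-1) ^+ tau :> int.
  by rewrite -signr_addb -odd_permM /pi mulgKV.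
set t := (-1) ^+ tau.
have -> : odd_perm pi = odd m (+) odd (#|F| + `|gcdz s0 s1|).
  by rewrite /odd_perm card_ord card_porbits_pi.
rewrite prod_edge_sign oddD !signr_addb !signr_odd -dvdz_gcd.
have -> : (-1) ^+ `|gcdz s0 s1| = (if (2 %| gcdz s0 s1)%Z then 1 else -1) :> int.
  by rewrite -signr_odd dvdzE dvdn2; case: odd.
have : (-1) ^+ #|F| * (-1) ^+ #|F| = 1 :> int by rewrite -expr2 sqrr_sign.
move: (_ ^+ #|F|) ((-1) ^+ m) t (if _ then _ else _) => f A B e ff.
have -> : A * (f * e) * B * f = f * f * (B * A * e) by ring.
by rewrite ff mul1r.
Qed.

End TorusMatching.

(** * Exponents of a matching as level increments *)

Lemma clockwise_right (s s' u : Z2) :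
  clockwise_side s s' u (u + (1, 0)) = (s' == s + (0, 1)) && (u == s').
Proof.
case: s s' u => [a c] [a' c'] [x y].
by rewrite /clockwise_side !inE !xpair_eqE /=; lia.
Qed.

Lemma clockwise_up (s s' u : Z2) :
  clockwise_side s s' u (u + (0, 1)) = (s' == s + (-1, 0)) && (u == s).
Proof.
case: s s' u => [a c] [a' c'] [x y].
by rewrite /clockwise_side !inE !xpair_eqE /=; lia.
Qed.

Definition meets (L : set Z2) (n : nat) (P : nat -> Z2) (s : Z2) : bool :=
  `[< exists2 k, (k < n)%N & L (P k - s) >].

Lemma meetsP L n P s :
  reflect (exists2 k, (k < n)%N & L (P k - s)) (meets L n P s).
Proof. exact: asboolP. Qed.

(** A common form for the three straight pieces that make up the two paths. *)
Definition straight_step (e p : Z2) (n : nat) (u u' : Z2) : Prop :=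
  exists2 k, (k < n)%N & u = p + e *~ k%:Z /\ u' = u + e.

(** A square to the left of a rightward step lies just above it, so the black square has its corner
    on the path and its domino points down. The three lemmas that follow treat the other side and
    the upward steps in the same way. *)
Lemma cross_right_left L p n s d :
  (exists v u u', [/\ L v, straight_step (1, 0) p n u u'
    & clockwise_side (s + d + v) (s + v) u u']) <->
  (d == (0, -1)) && meets L n (fun k => p + (k%:Z, 0)) s.
Proof.
split=> [[v [u [u' [Lv [k lt_k [uE ->]]]]]]|/andP[/eqP -> /meetsP[k lt_k Lk]]].
  rewrite clockwise_right => /andP[/eqP E1 /eqP E2].
  have dE : d = (0, -1).
    by move: E1; case: (s) (d) (v) => [a c] [a' c'] [x y] [/=] *; congr pair; lia.
  rewrite dE eqxx; apply/meetsP; exists k => //.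
  suff -> : p + (k%:Z, 0) - s = v by [].
  move: E2; rewrite uE mulrz_pair mul1r mul0r.
  by case: (s) (p) (v) => [a c] [a' c'] [x y] [/=] *; congr pair; rewrite /=; lia.
exists (p + (k%:Z, 0) - s), (p + (k%:Z, 0)), (p + (k%:Z, 0) + (1, 0)); split=> //.
  by exists k => //; rewrite mulrz_pair mul1r mul0r.
by rewrite clockwise_right; case: (s) (p) => [a c] [x y]; rewrite !xpair_eqE /=; lia.
Qed.

Lemma cross_right_right L p n s d :
  (exists v u u', [/\ L v, straight_step (1, 0) p n u u'
    & clockwise_side (s + v) (s + d + v) u u']) <->
  (d == (0, 1)) && meets L n (fun k => p + (k%:Z, -1)) s.
Proof.
split=> [[v [u [u' [Lv [k lt_k [uE ->]]]]]]|/andP[/eqP -> /meetsP[k lt_k Lk]]].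
  rewrite clockwise_right => /andP[/eqP E1 /eqP E2].
  have dE : d = (0, 1).
    by move: E1; case: (s) (d) (v) => [a c] [a' c'] [x y] [/=] *; congr pair; lia.
  rewrite dE eqxx; apply/meetsP; exists k => //.
  suff -> : p + (k%:Z, -1) - s = v by [].
  move: E2; rewrite uE dE mulrz_pair mul1r mul0r.
  by case: (s) (p) (v) => [a c] [a' c'] [x y] [/=] *; congr pair; rewrite /=; lia.
exists (p + (k%:Z, -1) - s), (p + (k%:Z, 0)), (p + (k%:Z, 0) + (1, 0)); split=> //.
  by exists k => //; rewrite mulrz_pair mul1r mul0r.
by rewrite clockwise_right; case: (s) (p) => [a c] [x y]; rewrite !xpair_eqE /=; lia.
Qed.

Lemma cross_up_left L p n s d :
  (exists v u u', [/\ L v, straight_step (0, 1) p n u u'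
    & clockwise_side (s + d + v) (s + v) u u']) <->
  (d == (1, 0)) && meets L n (fun k => p + (-1, k%:Z)) s.
Proof.
split=> [[v [u [u' [Lv [k lt_k [uE ->]]]]]]|/andP[/eqP -> /meetsP[k lt_k Lk]]].
  rewrite clockwise_up => /andP[/eqP E1 /eqP E2].
  have dE : d = (1, 0).
    by move: E1; case: (s) (d) (v) => [a c] [a' c'] [x y] [/=] *; congr pair; lia.
  rewrite dE eqxx; apply/meetsP; exists k => //.
  suff -> : p + (-1, k%:Z) - s = v by [].
  move: E2; rewrite uE dE mulrz_pair mul1r mul0r.
  by case: (s) (p) (v) => [a c] [a' c'] [x y] [/=] *; congr pair; rewrite /=; lia.
exists (p + (-1, k%:Z) - s), (p + (0, k%:Z)), (p + (0, k%:Z) + (0, 1)); split=> //.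
  by exists k => //; rewrite mulrz_pair mul1r mul0r.
by rewrite clockwise_up; case: (s) (p) => [a c] [x y]; rewrite !xpair_eqE /=; lia.
Qed.

Lemma cross_up_right L p n s d :
  (exists v u u', [/\ L v, straight_step (0, 1) p n u u'
    & clockwise_side (s + v) (s + d + v) u u']) <->
  (d == (-1, 0)) && meets L n (fun k => p + (0, k%:Z)) s.
Proof.
split=> [[v [u [u' [Lv [k lt_k [uE ->]]]]]]|/andP[/eqP -> /meetsP[k lt_k Lk]]].
  rewrite clockwise_up => /andP[/eqP E1 /eqP E2].
  have dE : d = (-1, 0).
    by move: E1; case: (s) (d) (v) => [a c] [a' c'] [x y] [/=] *; congr pair; lia.
  rewrite dE eqxx; apply/meetsP; exists k => //.
  suff -> : p + (0, k%:Z) - s = v by [].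
  move: E2; rewrite uE mulrz_pair mul1r mul0r.
  by case: (s) (p) (v) => [a c] [a' c'] [x y] [/=] *; congr pair; rewrite /=; lia.
exists (p + (0, k%:Z) - s), (p + (0, k%:Z)), (p + (0, k%:Z) + (0, 1)); split=> //.
  by exists k => //; rewrite mulrz_pair mul1r mul0r.
by rewrite clockwise_up; case: (s) (p) => [a c] [x y]; rewrite !xpair_eqE /=; lia.
Qed.

Lemma u0_stepE (x0 : int) u u' : 0 <= x0 ->
  u0_step x0 u u' <-> straight_step (1, 0) 0 `|x0| u u'.
Proof.
move=> x0_ge0; split=> [/and3P[/eqP u2 u1 /eqP ->]|[k lt_k [-> ->]]].
  exists `|u.1|%N; first by lia.
  split=> //; rewrite mulrz_pair mul1r mul0r add0r.
  by case: u u1 u2 => x y /= u1 ->; congr pair; lia.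
by rewrite mulrz_pair /u0_step /= eqxx andbT; lia.
Qed.

Lemma u1_stepE (x1 y1 : int) u u' : 0 <= x1 -> 0 <= y1 ->
  u1_step x1 y1 u u' <->
  straight_step (0, 1) 0 `|y1| u u' \/ straight_step (1, 0) (0, y1) `|x1| u u'.
Proof.
move=> x1_ge0 y1_ge0; split=> [/orP[]/and3P[/eqP E1 E2 /eqP ->]|[] [k lt_k [-> ->]]].
- left; exists `|u.2|%N; first by lia.
  split=> //; rewrite mulrz_pair mul1r mul0r add0r.
  by case: u E1 E2 => x y /= -> ?; congr pair; lia.
- right; exists `|u.1|%N; first by lia.
  split=> //; rewrite mulrz_pair mul1r mul0r.
  by case: u E1 E2 => x y /= -> ?; congr pair; rewrite /=; lia.
- by apply/orP; left; rewrite mulrz_pair /= eqxx andbT; lia.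
by apply/orP; right; rewrite mulrz_pair /= eqxx andbT; lia.
Qed.

Lemma crossing_u0E L (x0 : int) s d : 0 <= x0 ->
  crossing_exponent L (u0_step x0) (s, s + d)
  = ((d == (0, -1)) && meets L `|x0| (fun k => (k%:Z, 0)) s : nat)%:Z
    - ((d == (0, 1)) && meets L `|x0| (fun k => (k%:Z, -1)) s : nat)%:Z.
Proof.
move=> x0_ge0; rewrite /crossing_exponent.
have P0 (c : int) : (fun k : nat => (0, 0) + (k%:Z, c) : Z2) = (fun k => (k%:Z, c)).
  by apply: funext => k; congr pair; rewrite /= add0r.
congr (Posz (nat_of_bool _) - Posz (nat_of_bool _)).
  rewrite -P0; apply/asboolP/idP; rewrite -cross_right_left.
    by case=> v [u [u' [Lv /u0_stepE st cl]]]; exists v, u, u'; split=> //; apply: st.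
  by case=> v [u [u' [Lv st cl]]]; exists v, u, u'; split=> //; apply/u0_stepE.
rewrite -P0; apply/asboolP/idP; rewrite -cross_right_right.
  by case=> v [u [u' [Lv /u0_stepE st cl]]]; exists v, u, u'; split=> //; apply: st.
by case=> v [u [u' [Lv st cl]]]; exists v, u, u'; split=> //; apply/u0_stepE.
Qed.

Lemma crossing_u1E L (x1 y1 : int) s d : 0 <= x1 -> 0 <= y1 ->
  crossing_exponent L (u1_step x1 y1) (s, s + d)
  = ((d == (1, 0)) && meets L `|y1| (fun k => (-1, k%:Z)) s : nat)%:Z
    - ((d == (-1, 0)) && meets L `|y1| (fun k => (0, k%:Z)) s : nat)%:Z
    + (((d == (0, -1)) && meets L `|x1| (fun k => (k%:Z, y1)) s : nat)%:Z
    - ((d == (0, 1)) && meets L `|x1| (fun k => (k%:Z, y1 - 1)) s : nat)%:Z).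
Proof.
move=> x1_ge0 y1_ge0; rewrite /crossing_exponent.
have P0 (c : int) : (fun k : nat => (0, 0) + (c, k%:Z) : Z2) = (fun k => (c, k%:Z)).
  by apply: funext => k; congr pair; rewrite /= add0r.
have P1 (c : int) : (fun k : nat => (0, y1) + (k%:Z, c) : Z2) = (fun k => (k%:Z, y1 + c)).
  by apply: funext => k; congr pair; rewrite /= add0r.
have P1' : (fun k : nat => (k%:Z, y1) : Z2) = (fun k => (0, y1) + (k%:Z, 0)).
  by rewrite P1 addr0.
rewrite addrACA -opprD P1' -(P1 (-1)) -(P0 (-1)) -(P0 0).
(* An edge crosses horizontal or vertical segments, never both, so the crossings of the two pieces
   exclude each other and their indicators add up. *)
have split_or (A B : bool) : ~~ (A && B) -> (A : nat)%:Z + (B : nat)%:Z = (A || B : nat)%:Z.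
  by case: A B => [] [].
rewrite !split_or; last 2 first.
- by apply/negP => /andP[/andP[/eqP -> _] /andP[/eqP]].
- by apply/negP => /andP[/andP[/eqP -> _] /andP[/eqP]].
congr (Posz (nat_of_bool _) - Posz (nat_of_bool _)).
  apply/asboolP/orP; rewrite -cross_right_left -cross_up_left.
    case=> v [u [u' [Lv /u1_stepE st cl]]].
    by have [//|//|st'|st'] := st; [left|right]; exists v, u, u'.
  by case=> -[v [u [u' [Lv st cl]]]]; exists v, u, u'; split=> //;
    apply/u1_stepE => //; [left|right].
apply/asboolP/orP; rewrite -cross_right_right -cross_up_right.
  case=> v [u [u' [Lv /u1_stepE st cl]]].
  by have [//|//|st'|st'] := st; [left|right]; exists v, u, u'.
by case=> -[v [u [u' [Lv st cl]]]]; exists v, u, u'; split=> //;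
  apply/u1_stepE => //; [left|right].
Qed.

Lemma meets_sum (L : set Z2) n P s : subgroup L ->
  (forall k k', (k < n)%N -> (k' < n)%N -> L (P k - P k') -> k = k') ->
  (meets L n P s : nat)%:Z = \sum_(k < n) (`[< L (P k - s) >] : nat)%:Z.
Proof.
move=> Lsub P_inj; have [[k lt_k Lk]|N] := meetsP L n P s; last first.
  rewrite big1 // => k _; case: asboolP => // Lk.
  by case: N; exists k.
rewrite (bigD1 (Ordinal lt_k)) //= (asboolT Lk) big1 ?addr0 // => k' ne.
case: asboolP => // Lk'; case/eqP: ne; apply: val_inj; apply: P_inj => //=.
by have := subgroupB Lsub Lk' Lk; rewrite opprB addrA subrK.
Qed.

Section Crossings.

Variables (L : set Z2) (m : nat) (b : 'I_m -> Z2).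
Hypothesis Lsub : subgroup L.
Hypothesis Leven : forall v, L v -> (2 %| v.1 + v.2)%Z.
Hypothesis bT : transversal L b black.
Variables (d : 'I_m -> Z2) (D : int -> int -> Z2).
Hypothesis DL : lifts L b d D.

Lemma sum_at (e p : Z2) :
  \sum_i ((d i == e) && `[< L (p - b i) >] : nat)%:Z
  = if black p then ind D e p.1 p.2 else 0.
Proof.
have [bB b_rep b_inj] := bT; case: ifP => [bp|bp]; last first.
  rewrite big1 // => i _; case: asboolP => [Li|_]; last by rewrite andbF.
  by rewrite (black_near Leven bT Li) in bp.
have [i Li] := b_rep p bp; rewrite (bigD1 i) //= (asboolT Li) andbT.
rewrite /ind (DL (i := i)) -?surjective_pairing // big1 ?addr0 // => j ne.
case: asboolP => [Lj|_]; last by rewrite andbF.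
case/eqP: ne; apply: b_inj.
by have := subgroupB Lsub Li Lj; rewrite opprB [X in L X]addrC subrKA.
Qed.

Lemma sum_meets (e : Z2) n P :
  (forall k k', (k < n)%N -> (k' < n)%N -> L (P k - P k') -> k = k') ->
  \sum_i ((d i == e) && meets L n P (b i) : nat)%:Z
  = \sum_(k < n) if black (P k) then ind D e (P k).1 (P k).2 else 0.
Proof.
move=> P_inj; under [RHS]eq_bigr do rewrite -sum_at.
rewrite exchange_big /=; apply: eq_bigr => i _.
have [_|_] /= := eqVneq; last by rewrite big1.
exact: meets_sum.
Qed.

Variable g : int -> int -> int.
Hypothesis gL : is_level D g.

Variables x0 x1 y1 : int.
Hypothesis x0_gt0 : 0 < x0.
Hypothesis y1_gt0 : 0 < y1.
Hypothesis x1_ge0 : 0 <= x1 < x0.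
Hypothesis LE : forall v, L v <-> exists k n : int, v = (x0 * k + x1 * n, y1 * n).

(** A half-open segment no longer than [x0] has no two points equivalent modulo [L], so each orbit
    of edges is counted at most once along it. *)
Lemma horizontal_free (c c' : int) (k k' n : nat) : n%:Z <= x0 ->
  (k < n)%N -> (k' < n)%N -> L ((k%:Z, c) - (k'%:Z, c)) -> k = k'.
Proof.
move=> n_le lt_k lt_k' /LE[q [r [/= E1 E2]]].
have r0 : r = 0 by nia.
rewrite r0 in E1; have q0 : q = 0 by nia.
by rewrite q0 in E1; lia.
Qed.

Lemma vertical_free (c : int) (k k' n : nat) : n%:Z <= y1 ->
  (k < n)%N -> (k' < n)%N -> L ((c, k%:Z) - (c, k'%:Z)) -> k = k'.
Proof.
move=> n_le lt_k lt_k' /LE[q [r [/= E1 E2]]].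
have r0 : r = 0 by nia.
by rewrite r0 in E2; lia.
Qed.

(** The signed crossing of a single step is the increment [dlevel_x] there, and the sum
    telescopes. *)
Lemma horizontal_crossings (n : nat) (c : int) : n%:Z <= x0 ->
  \sum_i (((d i == (0, -1)) && meets L n (fun k => (k%:Z, c)) (b i) : nat)%:Z
    - ((d i == (0, 1)) && meets L n (fun k => (k%:Z, c - 1)) (b i) : nat)%:Z)
  = g n%:Z c - g 0 c.
Proof.
move=> n_le; have [gx _] := gL.
rewrite sumrB !sum_meets; try by move=> k k'; exact: horizontal_free.
rewrite -sumrB (telescope_nat n (F := g^~ c) (f := dlevel_x D ^~ c)) //.
rewrite [RHS]addrC addKr; apply: eq_bigr => k _; rewrite /dlevel_x /black /=.
have -> : (2 %| k%:Z + (c - 1))%Z = ~~ (2 %| k%:Z + c)%Z by lia.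
by case: ifP => _ /=; rewrite ?subr0 ?sub0r.
Qed.

Lemma odd_count (n : nat) :
  \sum_(k < n) ((~~ (2 %| k%:Z)%Z : nat)%:Z) = (n%:Z %/ 2)%Z.
Proof.
elim: n => [|n IHn]; first by rewrite big_ord0.
by rewrite big_ord_recr /= IHn; lia.
Qed.

(** The level compares the crossings with those of the brick wall, which has one brick across the
    column at each odd height; the last term counts these bricks. *)
Lemma vertical_crossings (n : nat) : n%:Z <= y1 ->
  \sum_i (((d i == (1, 0)) && meets L n (fun k => (-1, k%:Z)) (b i) : nat)%:Z
    - ((d i == (-1, 0)) && meets L n (fun k => (0, k%:Z)) (b i) : nat)%:Z)
  = g 0 n%:Z - g 0 0 + (n%:Z %/ 2)%Z.
Proof.
move=> n_le; have [_ gy] := gL.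
rewrite sumrB !sum_meets; try by move=> k k'; exact: vertical_free.
rewrite -sumrB (telescope_nat n (F := g 0) (f := dlevel_y D 0)) //.
rewrite (addrC (g 0 0)) addrK -odd_count -big_split /=.
apply: eq_bigr => k _; rewrite /dlevel_y /black /= add0r.
have -> : (2 %| -1 + k%:Z)%Z = ~~ (2 %| k%:Z)%Z by lia.
by rewrite !add0r; case: (2 %| _)%Z => /=; lia.
Qed.

Lemma exponent_u0 :
  \sum_i crossing_exponent L (u0_step x0) (b i, b i + d i) = shift g (x0, 0).
Proof.
under eq_bigr do rewrite crossing_u0E ?(ltW x0_gt0) //.
have := @horizontal_crossings `|x0| 0; rewrite gtz0_abs // sub0r => -> //.
Qed.

Lemma exponent_u1 :
  \sum_i crossing_exponent L (u1_step x1 y1) (b i, b i + d i)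
  = shift g (x1, y1) + (y1 %/ 2)%Z.
Proof.
have [x1_0 x1_lt] := andP x1_ge0.
under eq_bigr do rewrite crossing_u1E ?(ltW y1_gt0) //.
have ay : `|y1|%N%:Z = y1 by rewrite gtz0_abs.
have ax : `|x1|%N%:Z = x1 by rewrite gez0_abs.
rewrite big_split /= vertical_crossings ?horizontal_crossings ?ax ?ay //; last exact: ltW.
by rewrite /shift /=; ring.
Qed.

End Crossings.

(** * Coefficients of the Kasteleyn determinant *)

Lemma lcoef_lmonom k (c : int) l : lcoef k (lmonom c l) = if l == k then c else 0.
Proof. by rewrite /lcoef /lmonom mcoeffU; case: (l == k). Qed.

Lemma lcoef_sum k (I : Type) (r : seq I) (P : pred I) (F : I -> laurent) :
  lcoef k (\sum_(i <- r | P i) F i) = \sum_(i <- r | P i) lcoef k (F i).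
Proof. by apply: (big_morph (lcoef k)); [exact: mcoeffD | exact: mcoeff0]. Qed.

Lemma lmonom_prod (I : Type) (r : seq I) (c : I -> int) (k : I -> Z2) :
  \prod_(i <- r) lmonom (c i) (k i) = lmonom (\prod_(i <- r) c i) (\sum_(i <- r) k i).
Proof.
elim: r => [|i r IHr]; first by rewrite !big_nil.
by rewrite !big_cons IHr; apply: lmonomM.
Qed.

Lemma lcoef_sign k (s : bool) (f : laurent) :
  lcoef k ((-1) ^+ s * f) = (-1) ^+ s * lcoef k f.
Proof.
by case: s; rewrite ?expr0 ?mul1r // expr1 !mulN1r; apply: mcoeffN.
Qed.

Lemma posz_sum (I : Type) (r : seq I) (P : pred I) (F : I -> nat) :
  (\sum_(i <- r | P i) F i)%N%:Z = \sum_(i <- r | P i) (F i)%:Z.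
Proof. exact: (big_morph Posz PoszD). Qed.

Section Determinant.

Variables (L : set Z2) (m : nat) (b w : 'I_m -> Z2) (x0 x1 y1 : int).

Definition exponent (d : 'I_m -> Z2) : Z2 :=
  (\sum_i crossing_exponent L (u0_step x0) (b i, b i + d i),
   \sum_i crossing_exponent L (u1_step x1 y1) (b i, b i + d i)).

Let dir (e : 'I_(size unit_vectors)) : Z2 := tnth (in_tuple unit_vectors) e.

Let dirs (f : {ffun 'I_m -> 'I_(size unit_vectors)}) (i : 'I_m) : Z2 := dir (f i).

Let admissible (s : 'S_m) := family (fun i e => `[< L (b i + dir e - w (s i)) >]).

Lemma sum_pair (I : Type) (r : seq I) (F G : I -> int) :
  \sum_(i <- r) (F i, G i) = (\sum_(i <- r) F i, \sum_(i <- r) G i) :> Z2.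
Proof.
elim: r => [|i r IHr]; first by rewrite !big_nil.
by rewrite !big_cons IHr.
Qed.

(** Expanding the entries too, a term is a permutation together with a choice of one edge for every
    black square, that is, a matching of the torus. *)
Lemma kasteleyn_coef k :
  lcoef k (\det (kasteleyn L x0 x1 y1 b w))
  = \sum_(s : 'S_m) \sum_(f in admissible s)
      if exponent (dirs f) == k
      then (-1) ^+ s * \prod_i edge_sign (b i, b i + dirs f i) else 0.
Proof.
rewrite /determinant lcoef_sum; apply: eq_bigr => s _.
rewrite lcoef_sign.
under eq_bigr do rewrite mxE big_tnth.
rewrite bigA_distr_big_dep lcoef_sum big_distrr; apply: eq_bigr => f _ /=.
rewrite lmonom_prod lcoef_lmonom sum_pair -/(exponent (dirs f)).
by case: ifP; rewrite ?mulr0.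
Qed.

Hypothesis Lsub : subgroup L.
Hypothesis Leven : forall v, L v -> (2 %| v.1 + v.2)%Z.
Hypothesis bT : transversal L b black.
Hypothesis wT : transversal L w (fun s => ~~ black s).
Hypothesis x0_gt0 : 0 < x0.
Hypothesis y1_gt0 : 0 < y1.
Hypothesis x1_ge0 : 0 <= x1 < x0.
Hypothesis LE : forall v, L v <-> exists k n : int, v = (x0 * k + x1 * n, y1 * n).

Lemma matching_exponent d D g : lifts L b d D -> is_level D g ->
  exponent d = (shift g (x0, 0), shift g (x1, y1) + (y1 %/ 2)%Z).
Proof.
move=> DL gL; rewrite /exponent.
rewrite (exponent_u0 Lsub Leven bT DL gL x0_gt0 y1_gt0 x1_ge0 LE).
by rewrite (exponent_u1 Lsub Leven bT DL gL x0_gt0 y1_gt0 x1_ge0 LE).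
Qed.

(** The sign of [matching_sign] read off the exponent, after removal of the contribution of the
    brick wall. *)
Definition parity_sign (k : Z2) : int :=
  if (2 %| k.1)%Z && (2 %| k.2 - (y1 %/ 2)%Z)%Z then 1 else -1.

Variable tau : 'S_m.
Hypothesis d_tau : forall i, L (b i + (1, 0) - w (tau i)).

(** The sign of a term depends only on its exponent, so nothing cancels: the coefficient is this
    sign times the number of terms with that exponent, and the given matching is one of them. *)
Lemma kasteleyn_coef_sign (sigma : 'S_m) (d : 'I_m -> Z2) :
  (forall i, d i \in unit_vectors) ->
  (forall i, L (b i + d i - w (sigma i))) ->
  sgz (lcoef (exponent d) (\det (kasteleyn L x0 x1 y1 b w)))
  = (-1) ^+ tau * (-1) ^+ m * parity_sign (exponent d).
Proof.
move=> d_unit d_sigma; set k := exponent d; set c := _ * _ * _.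
have c_sgn : sgz c = c.
  rewrite /c -(signr_odd _ m) !sgzM /parity_sign.
  by case: (odd_perm tau) (odd m) (_ && _) => [] [] []; rewrite ?expr0 ?expr1 ?sgzN1 ?sgz1.
have term (s : 'S_m) (f : {ffun 'I_m -> 'I_(size unit_vectors)}) :
    f \in admissible s ->
    exponent (dirs f) = k ->
    (-1) ^+ s * \prod_i edge_sign (b i, b i + dirs f i) = c :> int.
  move=> /familyP fF Ek; have f_unit i : dirs f i \in unit_vectors by apply: mem_tnth.
  have f_s i : L (b i + dirs f i - w (s i)) by apply/asboolP/fF.
  have [D DL] := lift_exists Lsub bT (dirs f).
  have [g gL] := level_exists (lift_perfect Lsub bT wT f_unit f_s DL).
  rewrite (matching_sign Lsub Leven bT wT f_unit f_s DL d_tau gL x0_gt0 y1_gt0 LE).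
  by rewrite /c -Ek (matching_exponent DL gL) /parity_sign /= addrK.
have /choice [f0 fE] i : exists e, dir e = d i.
  by have /tnthP[e ->] : d i \in in_tuple unit_vectors by []; exists e.
pose f := finfun f0; have df : dirs f = d by apply: funext => i; rewrite /dirs ffunE.
rewrite kasteleyn_coef.
have -> : \sum_(s : 'S_m) \sum_(f in admissible s)
      (if exponent (dirs f) == k
       then (-1) ^+ s * \prod_i edge_sign (b i, b i + dirs f i) else 0)
    = c * (\sum_(s : 'S_m)
        \sum_(f in admissible s)
          (exponent (dirs f) == k : nat))%N%:Z.
  rewrite posz_sum; under [in RHS]eq_bigr do rewrite posz_sum.
  rewrite big_distrr; apply: eq_bigr => s _; rewrite big_distrr; apply: eq_bigr => h hF.
  by have [/(term _ _ hF) ->|_] := eqVneq; rewrite /= ?mulr1 ?mulr0.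
rewrite sgzM c_sgn; set N := (\sum_(s : 'S_m) _)%N.
suff N_gt0 : (0 < N)%N by rewrite gtr0_sgz ?mulr1.
have fA : f \in admissible sigma.
  by apply/familyP => i; apply/asboolP; rewrite -/(dirs f i) df; apply: d_sigma.
rewrite lt0n sum_nat_eq0; apply/forallP => /(_ sigma); rewrite sum_nat_eq0.
move=> /forallP/(_ f); rewrite fA eqb0 => /negP; apply.
by apply/eqP; apply: congr1 df.
Qed.

End Determinant.

(** * From periodic tilings to matchings of the torus *)

Lemma valid_subgroup L : valid_lattice L -> subgroup L.
Proof.
move=> [p [q [_ _ _ Lpq]]]; split; first by apply/Lpq; exists 0, 0; rewrite !mulr0z addr0.
move=> u v /Lpq[k [n ->]] /Lpq[k' [n' ->]]; apply/Lpq; exists (k - k'), (n - n').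
by rewrite !mulrzBr opprD addrACA.
Qed.

Lemma valid_even L : valid_lattice L -> forall v, L v -> (2 %| v.1 + v.2)%Z.
Proof.
move=> [p [q [p_e q_e _ Lpq]]] v /Lpq[k [n ->]].
have even u : even_sublattice u || odd_coset u -> (2 %| u.1 + u.2)%Z.
  by case: u => x y; rewrite /odd_coset /even_sublattice /=; lia.
have := even _ q_e; have := even _ p_e; case: (p) (q) => [a c] [a' c'] /=.
move=> E E'; rewrite !mulrz_pair /=.
have -> : a * k + a' * n + (c * k + c' * n) = (a + c) * k + (a' + c') * n by ring.
by rewrite rpredD // dvdz_mulr.
Qed.

Section TilingMatching.

Variables (L : set Z2) (m : nat) (b w : 'I_m -> Z2).
Hypothesis Lsub : subgroup L.
Hypothesis Leven : forall v, L v -> (2 %| v.1 + v.2)%Z.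
Hypothesis bT : transversal L b black.
Hypothesis wT : transversal L w (fun s => ~~ black s).

Lemma white_neighbour s e : black s -> e \in unit_vectors -> ~~ black (s + e).
Proof. by case: s => x y; rewrite /black /= => bs; rewrite !inE => /or4P[] /eqP -> /=; lia. Qed.

Lemma matching_perm (d : 'I_m -> Z2) :
  (forall i, d i \in unit_vectors) ->
  (forall i j, L (b i + d i - (b j + d j)) -> i = j) ->
  exists sigma : 'S_m, forall i, L (b i + d i - w (sigma i)).
Proof.
have [bB _ _] := bT; have [_ w_rep _] := wT => d_unit d_inj.
have /choice [f fP] i : exists j, L (b i + d i - w j).
  by apply: w_rep; apply: white_neighbour.
have f_inj : injective f.
  move=> i j E; apply: d_inj.
  by have := subgroupB Lsub (fP i) (fP j); rewrite E opprB addrA subrK.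
by exists (perm f_inj) => i; rewrite permE.
Qed.

Lemma brick_matching : exists tau : 'S_m, forall i, L (b i + (1, 0) - w (tau i)).
Proof.
have [_ _ b_inj] := bT; apply: (matching_perm (d := fun=> (1, 0))) => // i j.
by rewrite opprD addrACA subrr addr0; apply: b_inj.
Qed.

Variable t : set (Z2 * Z2).
Hypotheses (tT : is_tiling t) (tL : periodic L t).

Lemma tiling_black s e e' : t (s, s + e) -> t (s, s + e') -> e = e'.
Proof.
have [_ t_disj _] := tT => te te'; apply: contrapT => ne.
apply: (t_disj _ _ te te' _ s); last by split; left.
by move=> /(congr1 snd) /addrI.
Qed.

Lemma tiling_white s s' u : t (s, u) -> t (s', u) -> s = s'.
Proof.
have [_ t_disj _] := tT => te te'; apply: contrapT => ne.
by apply: (t_disj _ _ te te' _ u); [case | split; right].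
Qed.

Lemma tiling_displacement s : black s ->
  exists2 e, e \in unit_vectors & t (s, s + e).
Proof.
have [t_dom _ t_cov] := tT => bs; have [[s1 s2] te] := t_cov s.
have /and3P[/= b1 b2 side] := t_dom _ te.
case=> /= E; last by rewrite E (negbTE b2) in bs.
by exists (s2 - s1); rewrite // E addrC subrK.
Qed.

Lemma tiling_matching : exists (sigma : 'S_m) (d : 'I_m -> Z2) (D : int -> int -> Z2),
  [/\ forall i, d i \in unit_vectors, forall i, L (b i + d i - w (sigma i)),
      lifts L b d D
    & forall s e, black s -> t (s, s + e) <-> D s.1 s.2 = e].
Proof.
have [bB _ b_inj] := bT.
have /choice [d0 dP] s : exists e, black s -> e \in unit_vectors /\ t (s, s + e).
  have [/tiling_displacement[e eu te]|] := boolP (black s); first by exists e.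
  by exists 0.
pose d i := d0 (b i).
have d_unit i : d i \in unit_vectors by have [] := dP _ (bB i).
have td i : t (b i, b i + d i) by have [] := dP _ (bB i).
have [sigma d_sigma] : exists sigma : 'S_m, forall i, L (b i + d i - w (sigma i)).
  (* Translating the domino of [b j] by this vector makes it share its white square with the domino
     of [b i]; in a tiling the two then coincide. *)
  apply: matching_perm => // i j Lv; apply: b_inj.
  have := td j; rewrite (tL Lv) /translate /=.
  rewrite [X in t (_, X)]addrC subrK => /(tiling_white (td i)) ->.
  by rewrite addrC addKr.
exists sigma, d, (fun x y => d0 (x, y)); split=> //.
  move=> i x y Lv; have [_] := dP _ (black_near Leven bT Lv).
  have := td i; rewrite (tL Lv) /translate /= addrAC.
  by rewrite [b i + _]addrC subrK => /tiling_black E /E.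
move=> [x y] e bs; have [_ ts] := dP _ bs; split=> [/(tiling_black ts)|<-] //.
Qed.

End TilingMatching.

(** * Heights, fluxes and levels *)

(** The explicit part [2 * y - (~~ (2 %| x + y)%Z : nat)%:Z] is the height function of the brick
    wall. Every unit segment is a side of exactly one black square, which decides the case in each
    increment. *)
Lemma height_level (t : set (Z2 * Z2)) (h : Z2 -> int) (D : int -> int -> Z2)
    (g : int -> int -> int) :
  is_height t h -> is_level D g ->
  (forall s e, black s -> t (s, s + e) <-> D s.1 s.2 = e) ->
  exists c, forall x y : int,
    h (x, y) = 4 * g x y + 2 * y - (~~ (2 %| x + y)%Z : nat)%:Z + c.
Proof.
move=> [_ hP] [gx gy] tD.
have step s e u u' : black s -> clockwise_side s (s + e) u u' ->
    h u' = h u + 1 - 4 * ind D e s.1 s.2.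
  move=> bs cl; have [h1 h2] := hP _ _ _ _ bs cl.
  rewrite /ind; case: eqP => [/tD -/(_ bs) /h2 ->|N]; first by rewrite mulr1 -addrA.
  by rewrite h1 ?mulr0 ?subr0 // => /tD -/(_ bs) E; apply: N.
pose F x y := h (x, y) - (4 * g x y + 2 * y - (~~ (2 %| x + y)%Z : nat)%:Z).
exists (F 0 0) => x y; suff <- : F x y = F 0 0 by rewrite /F addrC subrK.
apply: constant_of_increments => {}x {}y; rewrite /F ?gx ?gy.
  rewrite /dlevel_x; case: ifP => bs.
    have := @step (x, y) (0, -1) (x + 1, y) (x, y) bs.
    rewrite /clockwise_side !inE !xpair_eqE /= => /(_ ltac:(lia)).
    have -> : (2 %| x + 1 + y)%Z = false by lia.
    lia.
  have := @step (x, y - 1) (0, 1) (x, y) (x + 1, y) ltac:(rewrite /black /=; lia).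
  rewrite /clockwise_side !inE !xpair_eqE /= => /(_ ltac:(lia)).
  have -> : (2 %| x + 1 + y)%Z by lia.
  lia.
rewrite /dlevel_y; case: ifP => bs.
  have := @step (x, y) (-1, 0) (x, y) (x, y + 1) bs.
  rewrite /clockwise_side !inE !xpair_eqE /= => /(_ ltac:(lia)).
  have -> : (2 %| x + (y + 1))%Z = false by lia.
  lia.
have := @step (x - 1, y) (1, 0) (x, y + 1) (x, y) ltac:(rewrite /black /=; lia).
rewrite /clockwise_side !inE !xpair_eqE /= => /(_ ltac:(lia)).
have -> : (2 %| x + (y + 1))%Z by lia.
lia.
Qed.

Lemma dotD (R : realType) (f g : R * R) v : dot (f + g) v = dot f v + dot g v.
Proof. by rewrite /dot /=; ring. Qed.

Lemma dotMz (R : realType) (f : R * R) (n : int) v : dot (f *~ n) v = dot f v * n%:~R.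
Proof.
rewrite mulrzr.
suff H (k : nat) : dot (f *+ k) v = dot f v *+ k.
  case: n => k; first by rewrite -!pmulrn H.
  rewrite NegzE !mulrNz -!pmulrn -H /dot /=; ring.
elim: k => [|k IHk]; first by rewrite !mulr0n /dot /= !mul0r addr0.
by rewrite !mulrS dotD IHk.
Qed.

(** Along [v] the height of the brick wall grows by [2 * v.2]; division by 4 yields the half. *)
Lemma flux_dot (R : realType) (L : set Z2) (phi : R * R) (t : set (Z2 * Z2))
    (D : int -> int -> Z2) (g : int -> int -> int) v :
  is_flux L t phi -> is_level D g ->
  (forall s e, black s -> t (s, s + e) <-> D s.1 s.2 = e) ->
  L v -> (2 %| v.1 + v.2)%Z -> dot phi v = (shift g v)%:~R + v.2%:~R / 2.
Proof.
move=> [h hH hphi] gL tD Lv ve; have [c hE] := height_level hH gL tD.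
have := hphi v Lv 0; rewrite add0r [v]surjective_pairing -[0 : Z2]/(0, 0) !hE ve.
rewrite /shift; case: v {Lv ve} => x y /= E.
have Ez : 4 * g x y + 2 * y - 0 + c - (4 * g 0 0 + 2 * 0 - 0 + c)
          = 4 * (g x y - g 0 0) + 2 * y by ring.
move: E; rewrite Ez intrD.
by lra.
Qed.

(** * Parities of fluxes in the coordinates of the frame *)

Definition origin_sign (p : Z2) : int :=
  if (2 %| p.1)%Z && (2 %| p.2)%Z then 1 else -1.

(** Modulo 2, an even [k] changes nothing and an odd [k] exchanges the two factors. *)
Lemma origin_sign_line (p a : Z2) (k : int) :
  origin_sign p * origin_sign (p + a)
  = origin_sign (p + a *~ k) * origin_sign (p + a *~ k + a).
Proof.
case: p a => p1 p2 [a1 a2]; rewrite mulrz_pair /origin_sign /=.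
have [ek|ek] := boolP (2 %| k)%Z.
  have /dvdzP[q ->] := ek.
  have E (x y : int) : (2 %| x + y * (q * 2))%Z = (2 %| x)%Z by lia.
  have E' (x y : int) : (2 %| x + y * (q * 2) + y)%Z = (2 %| x + y)%Z by lia.
  by rewrite !E !E'.
have [q ->] : exists q : int, k = 2 * q + 1 by exists (k %/ 2)%Z; lia.
have E (x y : int) : (2 %| x + y * (2 * q + 1))%Z = (2 %| x + y)%Z by lia.
have E' (x y : int) : (2 %| x + y * (2 * q + 1) + y)%Z = (2 %| x)%Z by lia.
by rewrite !E !E' mulrC.
Qed.

(* Modulo 2, four integer points forming a fundamental parallelogram run over
   all parity classes, and the sign is 1 on exactly one of them. *)
Lemma origin_sign_parallelogram (p a c : Z2) :
  ~~ (2 %| a.1 * c.2 - a.2 * c.1)%Z ->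
  origin_sign p * origin_sign (p + a)
  = - (origin_sign (p + c) * origin_sign (p + c + a)).
Proof.
case: p a c => p1 p2 [a1 a2] [c1 c2]; rewrite /origin_sign /=.
have par (x : int) : exists q e : int, x = 2 * q + e /\ (e = 0 \/ e = 1).
  by exists (x %/ 2)%Z, (x %% 2)%Z; lia.
have [q1 [e1 [-> E1]]] := par a1; have [q2 [e2 [-> E2]]] := par a2.
have [r1 [f1 [-> F1]]] := par c1; have [r2 [f2 [-> F2]]] := par c2.
have [s1 [o1 [-> O1]]] := par p1; have [s2 [o2 [-> O2]]] := par p2.
have D (x y : int) : (2 %| 2 * x + y)%Z = (2 %| y)%Z by lia.
have -> : (2 * q1 + e1) * (2 * r2 + f2) - (2 * q2 + e2) * (2 * r1 + f1)
  = 2 * (2 * q1 * r2 + q1 * f2 + e1 * r2 - 2 * q2 * r1 - q2 * f1 - e2 * r1)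
    + (e1 * f2 - e2 * f1) by ring.
have A (x y x' y' : int) : 2 * x + y + (2 * x' + y') = 2 * (x + x') + (y + y') by ring.
rewrite !A !D.
by case: E1 E2 F1 F2 O1 O2 => -> [] -> [] -> [] -> [] -> [] ->.
Qed.

(** The basis dual to the frame lies in [L^*], hence has integer coordinates in [f] and [g]. The
    determinant in question is therefore invertible over the integers. *)
Lemma dual_basis_odd (R : realType) (L : set Z2) (x0 x1 y1 : int) (f g : R * R)
    (a c : Z2) :
  0 < x0 -> 0 < y1 ->
  (forall v, L v <-> exists k n : int, v = (x0 * k + x1 * n, y1 * n)) ->
  (forall e, dual_lattice L e -> exists k n : int, e = f *~ k + g *~ n) ->
  (dot f (x0, 0), dot f (x1, y1)) = (a.1%:~R, a.2%:~R) ->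
  (dot g (x0, 0), dot g (x1, y1)) = (c.1%:~R, c.2%:~R) ->
  ~~ (2 %| a.1 * c.2 - a.2 * c.1)%Z.
Proof.
move=> x0_gt0 y1_gt0 LE span [f0 f1] [g0 g1].
have x0_neq0 : x0%:~R != 0 :> R by rewrite intr_eq0 lt0r_neq0.
have y1_neq0 : y1%:~R != 0 :> R by rewrite intr_eq0 lt0r_neq0.
have [k [n [E0 E1]]] : exists k n : int, a.1 * k + c.1 * n = 1 /\ a.2 * k + c.2 * n = 0.
  have [|k [n E]] := span (x0%:~R^-1, - (x1%:~R / (x0%:~R * y1%:~R))).
    move=> v /LE[k [n ->]]; apply/intrP; exists k; rewrite /dot /=.
    by rewrite !intrD !intrM; field; rewrite ?x0_neq0 ?y1_neq0.
  have E0 := congr1 (fun e => dot e (x0, 0)) E.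
  have E1 := congr1 (fun e => dot e (x1, y1)) E.
  exists k, n; split; apply/eqP; rewrite -(eqr_int R) intrD !intrM.
    move: E0; rewrite dotD !dotMz f0 g0 => <-.
    by rewrite /dot /= mulr0 addr0 mulVf.
  move: E1; rewrite dotD !dotMz f1 g1 => <-; apply/eqP.
  by rewrite /dot /=; field; rewrite ?x0_neq0 ?y1_neq0.
have [k' [n' [E0' E1']]] : exists k n : int, a.1 * k + c.1 * n = 0 /\ a.2 * k + c.2 * n = 1.
  have [|k' [n' E]] := span (0, y1%:~R^-1).
    move=> v /LE[k' [n' ->]]; apply/intrP; exists n'; rewrite /dot /=.
    by rewrite !intrM; field.
  have E0' := congr1 (fun e => dot e (x0, 0)) E.
  have E1' := congr1 (fun e => dot e (x1, y1)) E.
  exists k', n'; split; apply/eqP; rewrite -(eqr_int R) intrD !intrM.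
    move: E0'; rewrite dotD !dotMz f0 g0 => <-.
    by rewrite /dot /= mul0r mulr0 addr0.
  move: E1'; rewrite dotD !dotMz f1 g1 => <-; apply/eqP.
  by rewrite /dot /= mul0r add0r mulVf.
apply/negP => /(dvdz_mulr (k * n' - n * k')).
have -> : (a.1 * c.2 - a.2 * c.1) * (k * n' - n * k')
  = (a.1 * k + c.1 * n) * (a.2 * k' + c.2 * n')
    - (a.2 * k + c.2 * n) * (a.1 * k' + c.1 * n') by ring.
by rewrite E0 E0' E1 E1'.
Qed.

(** * The sign of a flux and its changes *)

Section FluxSign.

Variables (R : realType) (L : set Z2) (x0 x1 y1 : int) (m : nat) (b w : 'I_m -> Z2).
Hypothesis Lvalid : valid_lattice L.
Hypothesis Lframe : lattice_frame L x0 x1 y1.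
Hypothesis bE : enumerates b (fun s => in_rectangle x0 y1 s && black s).
Hypothesis wE : enumerates w (fun s => in_rectangle x0 y1 s && ~~ black s).

(** Here [p] holds the increments of the level along the two generators, an affine function of the
    flux, and [c] is the global sign contributed by the brick wall and by [m]. *)
Lemma flux_sign_origin :
  exists2 c : int, c * c = 1 & forall phi : R * R, flux_set L phi ->
    exists p : Z2,
      [/\ dot phi (x0, 0) = p.1%:~R, dot phi (x1, y1) = p.2%:~R + y1%:~R / 2
        & flux_sign L x0 x1 y1 b w phi = (c * origin_sign p)%:~R].
Proof.
have [[x0_gt0 L0 _] [y1_gt0 _ _] [x1_bound L1]] := Lframe.
have Lsub := valid_subgroup Lvalid; have Leven := valid_even Lvalid.
have LE := frame_lattice Lvalid Lframe.
have black_inv s v : L v -> black (s + v) = black s.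
  by move=> Lv; apply: black_translate Leven _ _ Lv.
have bT : transversal L b black by apply: frame_transversal Lframe LE _ bE.
have wT : transversal L w (fun s => ~~ black s).
  by apply: frame_transversal Lframe LE _ wE => s v Lv; rewrite black_inv.
have [tau d_tau] := brick_matching Lsub bT wT.
exists ((-1) ^+ tau * (-1) ^+ m).
  by rewrite mulrACA -!expr2 !sqrr_sign.
move=> phi [t [tT tL tphi]].
have [sigma [d [D [d_unit d_sigma DL tD]]]] := tiling_matching Lsub Leven bT wT tT tL.
have [g gL] := level_exists (lift_perfect Lsub bT wT d_unit d_sigma DL).
have dot0 := flux_dot tphi gL tD L0 (Leven _ L0).
have dot1 := flux_dot tphi gL tD L1 (Leven _ L1).
have expE := matching_exponent Lsub Leven bT x0_gt0 y1_gt0 x1_bound LE DL gL.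
exists (shift g (x0, 0), shift g (x1, y1)); split=> //=.
  by rewrite dot0 mul0r addr0.
have -> : flux_sign L x0 x1 y1 b w phi = (sgz (lcoef (exponent L b x0 x1 y1 d)
              (\det (kasteleyn L x0 x1 y1 b w))))%:~R.
  rewrite /flux_sign; congr (sgz (lcoef _ _))%:~R; rewrite expE /flux_monomial.
  congr pair; first by rewrite dot0 mul0r addr0 intrKfloor.
  (* The half subtracted in the flux monomial when [y1] is odd is the remainder lost in
     [y1 %/ 2]. *)
  rewrite dot1 /= -[RHS](@intrKfloor R) /even_sublattice /=; congr Num.floor.
  rewrite intrD; have := Leven _ L1 => /= e1; case: ifP => ey.
    have /andP[_ /dvdzP[q ->]] := ey.
    by rewrite mulzK // intrM; field.
  have -> : y1%:~R = (y1 %/ 2)%Z%:~R * 2 + 1 :> R.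
    have {1}-> : y1 = (y1 %/ 2)%Z * 2 + 1 by lia.
    by rewrite intrD intrM.
  by field.
rewrite (kasteleyn_coef_sign Lsub Leven bT wT x0_gt0 y1_gt0 x1_bound LE d_tau d_unit d_sigma).
by rewrite expE /parity_sign /origin_sign /= addrK.
Qed.

End FluxSign.

Lemma ord2_cases (i j : 'I_2) : i != j -> i = 0 /\ j = 1 \/ i = 1 /\ j = 0.
Proof.
case: i j => [[|[|//]] ?] [[|[|//]] ?] // _; [left|right];
  by split; apply: val_inj.
Qed.

Theorem proposition8p3p4 (R : realType) (L : set Z2) (x0 x1 y1 : int)
    (m : nat) (b w : 'I_m -> Z2) (vs : 'I_2 -> R * R) (i j : 'I_2)
    (phi phi' : R * R) :
  valid_lattice L ->
  lattice_frame L x0 x1 y1 ->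
  enumerates b (fun s => in_rectangle x0 y1 s && black s) ->
  enumerates w (fun s => in_rectangle x0 y1 s && ~~ black s) ->
  flux_connecting_basis L (vs 0) (vs 1) ->
  i != j ->
  flux_set L phi -> flux_set L (phi + vs i) ->
  flux_set L phi' -> flux_set L (phi' + vs i) ->
  let sgn := @flux_sign R L x0 x1 y1 m b w in
  ((exists k : int, phi' - phi = vs i *~ k) ->
     sgn phi / sgn (phi + vs i) = sgn phi' / sgn (phi' + vs i)) /\
  ((exists k : int, phi' - phi = vs j + vs i *~ k) ->
     sgn phi / sgn (phi + vs i) = - (sgn phi' / sgn (phi' + vs i))).

Proof.
move=> Lvalid Lframe bE wE [[dualE _] _] ne_ij Fphi Fphi_i Fphi' Fphi'_i sgn.
have [[x0_gt0 L0 _] [y1_gt0 _ _] [_ L1]] := Lframe.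
have LE := frame_lattice Lvalid Lframe.
have [c cc sgnE] := flux_sign_origin R Lvalid Lframe bE wE.
have dual k : dual_lattice L (vs k).
  apply/dualE; case: k => [[|[|//]] lt_k].
    by exists 1, 0; rewrite mulr0z addr0; congr vs; apply: val_inj.
  by exists 0, 1; rewrite mulr0z add0r; congr vs; apply: val_inj.
have span e : dual_lattice L e -> exists k n : int, e = vs i *~ k + vs j *~ n.
  move=> /dualE[k [n ->]]; have [[-> ->]|[-> ->]] := ord2_cases ne_ij.
    by exists k, n.
  by exists n, k; rewrite addrC.
have coords k : exists a : Z2,
    (dot (vs k) (x0, 0), dot (vs k) (x1, y1)) = (a.1%:~R, a.2%:~R).
  have /intrP[a1 ->] := dual k _ L0; have /intrP[a2 ->] := dual k _ L1.
  by exists (a1, a2).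
have [a aE] := coords i; have [d dE] := coords j; case: (aE) (dE) => a1 a2 [d1 d2].
have odd_ad := dual_basis_odd x0_gt0 y1_gt0 LE span aE dE.
have unique (p q : Z2) (f : R * R) :
    dot f (x0, 0) = p.1%:~R -> dot f (x1, y1) = p.2%:~R + y1%:~R / 2 ->
    dot f (x0, 0) = q.1%:~R -> dot f (x1, y1) = q.2%:~R + y1%:~R / 2 -> p = q.
  case: p q => p1 p2 [q1 q2] /= -> -> E1 /addIr E2.
  by congr pair; apply/eqP; rewrite -(eqr_int R) ?E1 ?E2.
(* All signs are 1 or -1, so the quotient is a product and the global sign [c] drops out. *)
have sgnP f : flux_set L f -> flux_set L (f + vs i) -> exists p : Z2,
    [/\ dot f (x0, 0) = p.1%:~R, dot f (x1, y1) = p.2%:~R + y1%:~R / 2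
      & sgn f / sgn (f + vs i) = (origin_sign p * origin_sign (p + a))%:~R].
  move=> /sgnE[p [p1 p2 sp]] /sgnE[q [q1 q2 sq]]; exists p; split=> //.
  have <- : q = p + a.
    apply: unique q1 q2 _ _; rewrite dotD ?p1 ?p2 ?a1 ?a2 intrD //.
    by rewrite addrAC.
  rewrite /sgn sp sq; have [] : c = 1 \/ c = -1 by nia.
    by move=> ->; rewrite /origin_sign; case: ifP; case: ifP.
  by move=> ->; rewrite /origin_sign; case: ifP; case: ifP.
have [p [p1 p2 ->]] := sgnP _ Fphi Fphi_i.
have [p' [p1' p2' ->]] := sgnP _ Fphi' Fphi'_i.
split=> -[k /eqP]; rewrite subr_eq => /eqP E.
  suff -> : p' = p + a *~ k by rewrite (origin_sign_line p a k).
  apply: unique p1' p2' _ _; rewrite E dotD dotMz ?a1 ?a2 ?p1 ?p2;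
    by case: (a) (p) => u v [x y]; rewrite mulrz_pair /= intrD intrM; ring.
suff -> : p' = p + d + a *~ k.
  (* The quotient is first moved along its line to [p + d], then compared with the one at [p] across
     the parallelogram spanned by [a] and [d]. *)
  by rewrite -(origin_sign_line (p + d) a k) (origin_sign_parallelogram p odd_ad) intrN.
apply: unique p1' p2' _ _; rewrite E !dotD dotMz ?a1 ?a2 ?d1 ?d2 ?p1 ?p2;
  by case: (a) (p) (d) => u v [x y] [z t]; rewrite mulrz_pair /= !intrD intrM; ring.
Qed.
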